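(* Suppose $v\in S_n$ is vexillary. Then the Grothendieck polynomial $\mathfrak G_v=\mathfrak G_v(x_1,\dots,x_n)$ has degree $$\deg(\mathfrak G_v)=\#D(v)+\sum_{k=1}^n\rho_a(\tau_k(v)).$$
   Context: Permutations are written in one-line notation, $v_i=v(i)$. $v\in S_n$ is vexillary if it is $2143$-avoiding: there are no indices $i<j<k<l$ with $v_j<v_i<v_l<v_k$. Grothendieck polynomials: $S_n$ acts on $\mathbb Z[x_1,\dots,x_n]$ by permuting variables; $s_i=(i\ i+1)$; $\partial_i f=\frac{f-s_if}{x_i-x_{i+1}}$ and $\pi_i f=\partial_i\big((1-x_{i+1})f\big)$. Set $\mathfrak G_{w_0}=x_1^{n-1}x_2^{n-2}\cdots x_{n-1}$ for the longest permutation $w_0=n\,(n-1)\cdots1$, and $\mathfrak G_{ws_i}=\pi_i(\mathfrak G_w)$ whenever $w_i>w_{i+1}$; this is well defined. $\deg$ is the total degree. Rank function: $r_v(i,j)=\#\{k: k\le i,\ v_k\le j\}$. Rothe diagram: $D(v)=\{(i,j)\in[n]\times[n]: v_i>j\text{ and }v^{-1}(j)>i\}$ (row $i$, column $j$). Shape: $\lambda(v)$ is the partition obtained by sorting into decreasing order the code $(c_1,\dots,c_n)$, where $c_i$ is the number of cells in row $i$ of $D(v)$; it is identified with its Young diagram $\{(i,j): 1\le j\le\lambda_i\}$. For $v$ vexillary, each diagonal ($\{(i,j): j-i=c\}$ for a constant $c$) contains as many cells of $\lambda(v)$ as of $D(v)$. The filling $F_v$ of $\lambda(v)$: for each diagonal,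 place the values $r_v(i,j)$ of the cells $(i,j)\in D(v)$ in that diagonal into the cells of $\lambda(v)$ in the same diagonal, so that the entries weakly increase along the diagonal (from northwest to southeast). Then $\tau_k(v)=\{(i,j)\in\lambda(v): F_v(i,j)\ge k\}$. An antidiagonal path is a set $\{(i_1,j_1),\dots,(i_m,j_m)\}$ with $i_1<\cdots<i_m$ and $j_1>\cdots>j_m$ (not necessarily adjacent cells); $\rho_a(A)$ is the size of the largest antidiagonal path contained in $A$ (so $\rho_a(\emptyset)=0$). *)

(* Defs.v *)
From mathcomp Require Import all_boot all_order all_fingroup all_algebra.
From mathcomp Require Import mpoly zify.

Set Implicit Arguments.
Unset Strict Implicit.
Unset Printing Implicit Defensive.

Import GRing.Theory.
Local Open Scope ring_scope.

(* Indices are 0-based: 'I_n = {0, ..., n-1} stands for [n].  Comparisons and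
   differences of indices are unaffected; the exponent of x_i in w_0's monomial
   becomes n - i.+1. *)

Section Grothendieck.
Variable n : nat.
Implicit Types (i j : 'I_n) (f g : {mpoly int[n]}) (w : 'S_n).

Lemma msym_var (s : 'S_n) i :
  msym s ('X_i : {mpoly int[n]}) = 'X_(s i).
Proof.
rewrite msymX; congr mpolyX; apply/mnmP=> k.
by rewrite mnmE !mnm1E -(inj_eq (@perm_inj _ s)) permKV.
Qed.

Lemma ddiff_exists i j f :
  exists g, ('X_i - 'X_j) * g == f - msym (tperm i j) f.
Proof.
set s := tperm i j; pose D f := exists g, ('X_i - 'X_j) * g == f - msym s f.
have DD f1 f2 : D f1 -> D f2 -> D (f1 + f2).
  move=> [g1 /eqP e1] [g2 /eqP e2]; exists (g1 + g2); apply/eqP.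
  by rewrite mulrDr e1 e2 msymD opprD addrACA.
have DM f1 f2 : D f1 -> D f2 -> D (f1 * f2).
  move=> [g1 /eqP e1] [g2 /eqP e2].
  exists (g1 * f2 + g2 * msym s f1); apply/eqP.
  rewrite mulrDr !mulrA e1 e2 msymM !mulrBl (mulrC f2) (mulrC (msym s f2)).
  by rewrite addrA subrK.
have D1 : D 1 by exists 0; rewrite msym1 subrr mulr0.
have DZ c f1 : D f1 -> D (c *: f1).
  move=> [g1 /eqP e1]; exists (c *: g1); apply/eqP.
  by rewrite -scalerAr e1 msymZ scalerBr.
have DX k : D 'X_k.
  rewrite /D msym_var permE /=; case: eqP => [->|_].
    by exists 1; rewrite mulr1.
  case: eqP => [->|_]; first by exists (-1); rewrite mulrN1 opprB.
  by exists 0; rewrite subrr mulr0.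
elim/mpolyind: f => [|c m p _ _ Dp]; first by exists 0; rewrite msym0 subrr mulr0.
apply: DD Dp; apply: DZ; rewrite mpolyXE_id.
by apply: (big_ind D) => // k _; elim: (m k) => [|e IH]; rewrite ?expr0 ?exprS //; exact: DM.
Qed.

(* The quotient (f - s_{ij} f) / (x_i - x_j), which is a polynomial. *)
Definition ddiff i j f : {mpoly int[n]} := xchoose (ddiff_exists i j f).

Lemma ddiffP i j f : ('X_i - 'X_j) * ddiff i j f = f - msym (tperm i j) f.
Proof. exact/eqP/(xchooseP (ddiff_exists i j f)). Qed.

Definition demazure i j f : {mpoly int[n]} := ddiff i j ((1 - 'X_j) * f).

Definition w0 : 'S_n := perm (@rev_ord_inj n).

(* [groth w f] : f is obtained as the Grothendieck polynomial of w by some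
   chain of the defining recursion.  Products in 'S_n are read from left to
   right, so [(tperm i j * w)%g k = w (tperm i j k)] is the one-line notation of
   w with the entries in positions i and j exchanged, i.e. w s_i. *)
Inductive groth : 'S_n -> {mpoly int[n]} -> Prop :=
| groth_w0 : groth w0 (\prod_(i < n) 'X_i ^+ (n - i.+1))
| groth_step w f i j :
    j = i.+1 :> nat -> (w j < w i)%N -> groth w f ->
    groth (tperm i j * w)%g (demazure i j f).

Lemma perm_no_ascent w :
  (forall i j, j = i.+1 :> nat -> (w j < w i)%N) -> w = w0.
Proof.
move=> dec.
have decr d i j : (j = i + d.+1 :> nat)%N -> (w j + d.+1 <= w i)%N.
  elim: d j => [|d IH] j ed; first by have := dec i j; lia.
  have ltk : (i + d.+1 < n)%N by have := ltn_ord j; lia.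
  have := IH (Ordinal ltk) erefl; have := dec (Ordinal ltk) j; rewrite /=; lia.
apply/permP=> i; rewrite permE; apply/val_inj => /=.
have lt_in := ltn_ord i; have n0 : (0 < n)%N by lia.
have nl : (n.-1 < n)%N by lia.
have hi : (w i + i < n)%N.
  have [i0|ipos] := posnP i; first by rewrite i0 addn0 ltn_ord.
  have := decr i.-1 (Ordinal n0) i; have := ltn_ord (w (Ordinal n0)); rewrite /=; lia.
have lo : (n <= w i + i.+1)%N.
  have [il|ilt] := eqVneq (i : nat) n.-1; first by lia.
  have := decr (n.-1 - i.+1)%N i (Ordinal nl); rewrite /=; lia.
lia.
Qed.

Lemma groth_exists w : exists f, groth w f.
Proof.
have [m] := ubnP (\sum_(i < n) i * w i)%N; elim: m w => // m IH w.
rewrite ltnS => le_m.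
have [/existsP[i /existsP[j /andP[/eqP ij asc]]]|/existsPn na] :=
  boolP [exists i : 'I_n, exists j : 'I_n, (j == i.+1 :> nat) && (w i < w j)%N].
  have neq : j != i by rewrite -val_eqE /= ij; rewrite neq_ltn ltnSn orbT.
  pose w' := (tperm i j * w)%g.
  have wi : w' i = w j by rewrite permM tpermL.
  have wj : w' j = w i by rewrite permM tpermR.
  have [|f gf] := IH w'; last first.
    exists (demazure i j f).
    have -> : w = (tperm i j * w')%g by rewrite mulgA tperm2 mul1g.
    by apply: groth_step; rewrite ?wi ?wj.
  apply: leq_trans le_m.
  rewrite (bigD1 i) // (bigD1 j) //= wi wj.
  rewrite [X in (_ < X)%N](bigD1 i) // [X in (_ < _ + X)%N](bigD1 j) //=.
  rewrite (eq_bigr (fun k : 'I_n => k * w k)%N); last first.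
    by move=> k /andP[ki kj]; rewrite permM tpermD // eq_sym.
  by rewrite ij !mulSn; set S := bigop.body _ _ _; move: asc; lia.
have -> : w = w0.
  apply: perm_no_ascent => i j ij.
  have /existsPn/(_ j) := na i; rewrite ij eqxx /= -leqNgt leq_eqVlt.
  case/orP=> // /eqP/val_inj/perm_inj/(congr1 val) /= e.
  by move: ij; rewrite e => /n_Sn.
by eexists; exact: groth_w0.
Qed.

End Grothendieck.

Section Diagrams.
Variable n : nat.
Local Notation cell := ('I_n * 'I_n)%type.
Implicit Types (v : 'S_n) (c d : cell) (A P : {set cell}).
Local Open Scope nat_scope.

Definition vexillary v : Prop :=
  ~ exists i j k l : 'I_n,
      [/\ i < j, j < k & k < l] /\ [/\ v j < v i, v i < v l & v l < v k].

Definition rank_fun v (i j : 'I_n) : nat :=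
  #|[set k : 'I_n | (k <= i) && (v k <= j)]|.

Definition rothe v : {set cell} :=
  [set c : cell | (c.2 < v c.1) && (c.1 < (v^-1)%g c.2)].

Definition code v (i : 'I_n) : nat := #|[set j : 'I_n | (i, j) \in rothe v]|.

Definition lambda v : seq nat := sort geq [seq code v i | i <- enum 'I_n].

(* The Young diagram of [lambda v] fits in the n x n square, since it has n
   parts (zeros included), each at most n. *)
Definition shape v : {set cell} := [set c : cell | c.2 < nth 0 (lambda v) c.1].

(* c.2 - c.1 = d.2 - d.1, written without subtraction *)
Definition same_diag c d : bool := c.2 + d.1 == d.2 + c.1.

(* The rank_fun values, in increasing order, of the cells of D(v) lying on the
   diagonal of c. *)
Definition diag_values v c : seq nat :=
  sort leq [seq rank_fun v d.1 d.2 | d <- enum (rothe v) & same_diag d c].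

(* In a Young diagram, a cell (i, j) is preceded to the northwest on its
   diagonal by exactly min(i, j) cells (0-based indices). *)
Definition filling v c : nat := nth 0 (diag_values v c) (minn c.1 c.2).

Definition tau v (k : nat) : {set cell} :=
  [set c in shape v | k <= filling v c].

Definition antidiag_step c d : bool := (c.1 < d.1) && (d.2 < c.2).

Definition antidiag_path P : bool :=
  [exists s : #|P|.-tuple cell, sorted antidiag_step s && (P == [set c in s])].

Definition rho_a A : nat :=
  \max_(P : {set cell} | antidiag_path P && (P \subset A)) #|P|.

End Diagrams.

(* Main.v *)
(* The Hecke-algebra (Fomin-Kirillov) form of the recursion writes the
   Grothendieck polynomial of [w] as a sum over not necessarily reduced pipe
   dreams for [w], read column by column; the sign of a term depends only on its
   degree, so nothing cancels and the degree is the maximal number of crosses.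
   Peeling off one column at a time shows that this maximum is
   C(n + 1, 2) - sum_i L_i, where L_i is the length of a longest increasing
   subsequence of [w] starting at position i.
   For [v] vexillary, let southeast(i) be the set of positions p > i with v_p > v_i.
   Then C(n + 1, 2) - sum_i L_i = #D(v) + sum_i (#southeast(i) - LIS(southeast(i))).
   The cells of rank at least k in D(v) split into the diagrams of the patterns
   on southeast(i), for the dots i having exactly k - 1 dots strictly to their northwest;
   in the shape these blocks become translated Young diagrams placed
   antidiagonally, and the longest antidiagonal path of such a block has length
   #southeast(i) - LIS(southeast(i)). *)

Require Import Defs.
From mathcomp Require Import all_boot all_order all_fingroup all_algebra.
From mathcomp Require Import mpoly zify ring.

Set Implicit Arguments.
Unset Strict Implicit.
Unset Printing Implicit Defensive.

(** * Increasing subsequences and columns of pipe dreams *)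

(* The length of a longest increasing subsequence of [s] with entries above [x]. *)
Fixpoint lis (x : nat) (s : seq nat) : nat :=
  if s is y :: t then
    if x < y then maxn (lis x t) (lis y t).+1 else lis x t
  else 0.

Fixpoint lsum (s : seq nat) : nat :=
  if s is x :: t then (lis x t).+1 + lsum t else 0.

(* [pass u b w]: the first column of a pipe dream, read from top to bottom, turns
   the word [u] into [w] and has [b] elbows.  The letter at the current position
   moves on; a cross ([pass_stay], [pass_swap]) sorts it decreasingly with its
   right neighbour, as in the 0-Hecke monoid. *)
Inductive pass : seq nat -> nat -> seq nat -> Prop :=
| pass_end c : pass [:: c] 1 [:: c]
| pass_skip c d t b w : pass (d :: t) b w -> pass (c :: d :: t) b.+1 (c :: w)
| pass_stay c d t b w :
    d < c -> pass (d :: t) b w -> pass (c :: d :: t) b (c :: w)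
| pass_swap c d t b w :
    c < d -> pass (c :: t) b w -> pass (c :: d :: t) b (d :: w).

Lemma lis_le x y s : x <= y -> lis y s <= lis x s.
Proof.
elim: s x y => //= z s IH x y le_xy; have := IH x y le_xy.
have := IH y z; case: (ltnP y z); case: (ltnP x z); lia.
Qed.

Lemma lis_size x s : lis x s <= size s.
Proof. by elim: s x => //= y t IH x; have := IH x; have := IH y; case: ifP;
  lia. Qed.

Lemma lsum_size s : lsum s <= 'C((size s).+1, 2).
Proof.
by elim: s => //= x t IH; have := lis_size x t; rewrite binS bin1; lia.
Qed.

Lemma lis_eq_all x y s : x <= y -> all (ltn y) s -> lis x s = lis y s.
Proof.
by move=> le_xy; elim: s => //= z s IH /andP[yz /IH ->];
  rewrite yz (leq_ltn_trans le_xy yz).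
Qed.

(** A cross sorts two letters decreasingly, which may destroy increasing subsequences but creates
    none. *)
Lemma pass_lis u b w : pass u b w -> forall x, lis x w <= lis x u.
Proof.
elim=> // {u b w} [c d t b w _|c d t b w dc _|c d t b w cd _] IH x /=.
- by move: (IH x) (IH c) => /=; do !case: ifP; lia.
- by move: (IH x) (IH c) => /=; do !case: ifP; lia.
- move: (IH x) (IH d) => /=; have -> : d < c = false by lia.
  rewrite cd; do !case: ifP; try lia.
Qed.

Lemma pass_perm u b w : pass u b w -> perm_eq u w.
Proof.
elim=> // {u b w} [c d t b w _|c d t b w _ _|c d t b w _ _] IH.
- by rewrite perm_cons.
- by rewrite perm_cons.
- rewrite -[c :: d :: t]/([:: c] ++ [:: d] ++ t) perm_catCA /= perm_cons //.
Qed.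

Lemma pass_consE u b a w : pass u b (a :: w) -> w != [::] ->
  exists d t c, pass (d :: t) c w /\
    [\/ u = [:: a, d & t] /\ b = c.+1, [/\ d < a, u = [:: a, d & t] & b = c]
      | [/\ d < a, u = [:: d, a & t] & b = c]].
Proof.
move=> pu; inversion_clear pu as [|? d t c ? pd|? d t ? ? da pd|d ? t ? ? da pd].
- by [].
- by exists d, t, c; split=> //; constructor 1.
- by exists d, t, b; split=> //; constructor 2.
- by exists d, t, b; split=> //; constructor 3.
Qed.

Lemma pass_gt0 u b w : pass u b w -> 0 < b.
Proof. by elim. Qed.

(** The second inequality bounds the degree: [behead u] is the word left to the later columns. The
    first one carries the induction: at an elbow the new head [c] adds [(lis c w).+1], which is
    covered by [lis 0 w] and the elbow. *)
Lemma pass_lsum u b w : pass u b w ->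
  lsum w + lis 0 w <= b + lsum u /\ lsum w <= b + lsum (behead u).
Proof.
elim=> [c|c d t {}b {}w pw [IH1 IH2]|c d t {}b {}w dc pw [IH1 IH2]
       |c d t {}b {}w cd pw [IH1 IH2]].
- by rewrite /=; case: ifP.
- move: IH1 IH2 (pass_lis pw c) (@lis_le 0 c w isT) => /=.
  by do !case: ifP; lia.
- have := lis_le t (ltnW dc).
  move: IH1 IH2 (pass_lis pw c) => /=.
  have -> : c < d = false by lia.
  by do !case: ifP; lia.
- have := pass_lis pw d.
  move: IH1 IH2 => /=.
  have -> : d < c = false by lia.
  by rewrite cd; do !case: ifP; lia.
Qed.

(* An optimal column: the letter that starts the pass also starts a longest
   increasing subsequence of [w]. *)
Lemma pass_exists_lis w : w != [::] -> uniq w -> 0 \notin w ->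
  exists c t b, [/\ pass (c :: t) b w, lsum w + lis 0 w = b + lsum (c :: t),
    forall x, lis x w = lis x (c :: t) & (lis c t).+1 = lis 0 w].
Proof.
elim: w => // a [|d w] IH _.
  rewrite inE eq_sym -lt0n => _ a0; exists a, [::], 1.
  by split; rewrite /= ?a0 //; exact: pass_end.
move: (d :: w) (isT : d :: w != [::]) IH => {}w w0 IH /= /andP[aw uw].
rewrite inE negb_or eq_sym -lt0n => /andP[a0 nw].
have {IH} [c [t [b [pw e1 e2 e3]]]] := IH w0 uw nw.
have nca : c != a.
  by apply: contraNneq aw => <-; rewrite -(perm_mem (pass_perm pw)) mem_head.
rewrite a0.
have [lt|ge] := ltnP (lis 0 w) (lis a w).+1.
  have e4 : lis a w = lis 0 w by have := @lis_le 0 a w isT; lia.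
  exists a, (c :: t), b.+1; split.
  - exact: pass_skip.
  - by move: e1 (e2 a) (e2 0) => /=; lia.
  - by move=> x; rewrite -[LHS]/(if x < a then _ else lis x w) !e2.
  - by rewrite -e2; lia.
have ca : c < a.
  rewrite ltn_neqAle nca leqNgt; apply/negP => ac.
  by move: ge (e2 a) e3 => /=; rewrite ac; lia.
have e4 : lis a w = lis a t.
  by rewrite e2 /=; have -> : a < c = false by lia.
have [eq|neq] := eqVneq (lis a w).+1 (lis 0 w).
  exists a, (c :: t), b; split.
  - exact: pass_stay.
  - by move: e1 (e2 a) (e2 0) => /=; lia.
  - by move=> x; rewrite -[LHS]/(if x < a then _ else lis x w) !e2.
  - by rewrite -e2; lia.
exists c, (a :: t), b; split.
- exact: pass_swap.
- by move: e1 => /=; rewrite ca; lia.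
- move=> x; move: (e2 x) => /=; rewrite ca e4 => ->.
  by do !case: ifP; lia.
- by rewrite /= ca; lia.
Qed.

(** The second bound of [pass_lsum] is attained with the least letter in front. If [w] starts with
    its minimum, put an elbow before an optimal column for the tail; otherwise a swap brings the
    minimum forward from the tail. *)
Lemma pass_exists_min w : w != [::] -> uniq w -> 0 \notin w ->
  exists c t b, [/\ pass (c :: t) b w, all (ltn c) t, lsum w = b + lsum t
    & forall z, c <= z -> lis z w = lis z t].
Proof.
elim: w => // a [|d w] IH _.
  move=> _ _; exists a, [::], 1; split => //=; try exact: pass_end.
  by move=> z; rewrite leqNgt; case: ifP.
move: (d :: w) (isT : d :: w != [::]) IH => {}w w0 IH /= /andP[aw uw].
rewrite inE negb_or eq_sym -lt0n => /andP[a0 nw].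
have [amin|] := boolP (all (ltn a) w).
  have [c [t [b [pw e1 e2 e3]]]] := pass_exists_lis w0 uw nw.
  exists a, (c :: t), b.+1; split.
  - exact: pass_skip.
  - by rewrite (perm_all _ (pass_perm pw)).
  - by have := lis_eq_all (leq0n a) amin; move: e1 => /=; lia.
  - by move=> z az; rewrite -e2 ltnNge az.
have {IH} [c [t [b [pw e1 e2 e3]]]] := IH w0 uw nw.
case/allPn => z zw /=; rewrite -leqNgt => za.
have cz : c <= z.
  move: zw; rewrite -(perm_mem (pass_perm pw)) inE => /predU1P[-> //|].
  by move/(allP e1) => /ltnW.
have ca : c < a.
  rewrite ltn_neqAle (leq_trans cz za) andbT.
  by apply: contraNneq aw => <-; rewrite -(perm_mem (pass_perm pw)) mem_head.
exists c, (a :: t), b; split.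
- exact: pass_swap.
- by rewrite /= ca.
- by rewrite /= e3 ?(ltnW ca) //; lia.
- by move=> y cy /=; rewrite !e3 // ltnW.
Qed.

(** * Operators of the 0-Hecke algebra *)

Fixpoint swap_at (i : nat) (w : seq nat) : seq nat :=
  match i, w with
  | 0, a :: b :: t => b :: a :: t
  | i'.+1, a :: t => a :: swap_at i' t
  | _, _ => w
  end.

Fixpoint descent_at (i : nat) (w : seq nat) : bool :=
  match i, w with
  | 0, a :: b :: t => b < a
  | i'.+1, a :: t => descent_at i' t
  | _, _ => false
  end.

Lemma perm_swap_at i w : perm_eq (swap_at i w) w.
Proof.
elim: i w => [|i IH] [|a w] //=; last by rewrite perm_cons.
by case: w => // b w; rewrite -[b :: _]/([:: b] ++ [:: a] ++ w) perm_catCA.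
Qed.

Lemma size_swap_at i w : size (swap_at i w) = size w.
Proof. exact/perm_size/perm_swap_at. Qed.

Lemma uniq_swap_at i w : uniq (swap_at i w) = uniq w.
Proof. exact/perm_uniq/perm_swap_at. Qed.

Section Hecke.
Import GRing.Theory.
Local Open Scope ring_scope.
Variable R : comPzRingType.
Implicit Types (F G : seq nat -> R).

(** The action of [a + b u_i], where [u_i F] is [F (swap_at i w) - F w] at a descent and 0
    elsewhere, so that the square of [u_i] is [- u_i]. *)
Definition hecke_op (i : nat) (a b : R) F : seq nat -> R := fun w =>
  a * F w + (if descent_at i w then b * (F (swap_at i w) - F w) else 0).

Lemma eq_hecke_op i a b F G : F =1 G -> hecke_op i a b F =1 hecke_op i a b G.
Proof. by move=> e w; rewrite /hecke_op !e. Qed.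

Lemma eq_hecke_op_at i a b F G w :
  F w = G w -> F (swap_at i w) = G (swap_at i w) ->
    hecke_op i a b F w = hecke_op i a b G w.
Proof. by rewrite /hecke_op => -> ->. Qed.

Lemma hecke_op_cons i a b F c t :
  hecke_op i.+1 a b F (c :: t) = hecke_op i a b (fun s => F (c :: s)) t.
Proof. by []. Qed.

Lemma hopC i j a b c d F w : (i.+2 <= j)%N ->
  hecke_op i a b (hecke_op j c d F) w = hecke_op j c d (hecke_op i a b F) w.
Proof.
elim: i j w F => [|i IH] [|[|j]] [|p w] F //=.
- by move=> _; rewrite /hecke_op /=; ring.
- case: w => [|q w] _; first by rewrite /hecke_op /=; case: j => [|j] /=; ring.
  rewrite /hecke_op /=; case: (descent_at j w); case: (q < p)%N => /=; ring.
- by move=> _; rewrite /hecke_op /=; ring.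
- by move=> ij; exact: (IH j.+1 w (fun s => F (p :: s))).
Qed.

(** The Yang-Baxter equation for the factors [1 + x u_i], cleared of the denominator in
    [(y - x) / (1 - x)]. It is checked for each relative order of three consecutive letters. *)
Lemma hecke_op_braid i x y F w : (i.+2 < size w)%N -> uniq w ->
  hecke_op i (1 - x) (y - x) (hecke_op i.+1 1 y (hecke_op i 1 x F)) w =
  hecke_op i.+1 1 x (hecke_op i 1 y (hecke_op i.+1 (1 - x) (y - x) F)) w.
Proof.
elim: i w F => [|i IH] [|a w] F //=; last first.
  by move=> sw /andP[_ uw]; exact: (IH w (fun s => F (a :: s))).
case: w => [|b [|c w]] // _ /=; rewrite !inE => /and3P[].
rewrite !negb_or => /and3P[ab ac _] /andP[bc _] _.
rewrite /hecke_op /=.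
case: (ltngtP b a) ab => // ba _; case: (ltngtP c a) ac => // ca _;
case: (ltngtP c b) bc => // cb _ /=; try lia; try ring.
Qed.

Lemma hecke_op_merge i x y F w :
  hecke_op i (1 - x) (y - x) (hecke_op i 1 x F) w = (1 - x) * hecke_op i 1 y F w.
Proof.
elim: i w F => [|i IH] [|a w] F; last exact: (IH w (fun s => F (a :: s))).
- by rewrite /hecke_op /=; ring.
- case: w => [|b w]; first by rewrite /hecke_op /=; ring.
  by rewrite /hecke_op /=; case: (ltngtP b a) => _ /=; ring.
- by rewrite /hecke_op /=; ring.
Qed.

Fixpoint hecke_col (x : nat -> R) (m : nat) F : seq nat -> R :=
  if m is m'.+1 then hecke_op m' 1 (x m') (hecke_col x m' F) else F.

Lemma eq_hecke_col x m F G : F =1 G -> hecke_col x m F =1 hecke_col x m G.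
Proof. by move=> e; elim: m => //= m IH; apply: eq_hecke_op. Qed.

Lemma eq_hecke_col_on (x : nat -> R) m F G w :
  (forall z, size z = size w -> uniq z -> F z = G z) -> uniq w ->
  hecke_col x m F w = hecke_col x m G w.
Proof.
elim: m w => [|m IH] w e uw /=; first exact: e.
by apply: eq_hecke_op_at; apply: IH => [z|];
  rewrite ?size_swap_at ?uniq_swap_at //; exact: e.
Qed.

Lemma eq_hecke_col_var (x y : nat -> R) m F :
  (forall i, (i < m)%N -> x i = y i) -> hecke_col x m F =1 hecke_col y m F.
Proof.
elim: m => //= m IH e w; rewrite e //; apply: eq_hecke_op => {}w.
by apply: IH => i im; apply: e; apply: ltnW.
Qed.

Lemma hecke_col_head x m F a t :
  hecke_col x m.+1 F (a :: t) =
  hecke_col (fun i => x i.+1) m (fun s => hecke_op 0 1 (x 0%N) F (a :: s)) t.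
Proof.
elim: m t => // m IH t;
  rewrite -[LHS]/(hecke_op m.+1 1 (x m.+1) (hecke_col x m.+1 F) (a :: t)).
by rewrite hecke_op_cons; apply: eq_hecke_op => s; apply: IH.
Qed.

Lemma hcolC x m i a b F w : (m < i)%N ->
  hecke_op i a b (hecke_col x m F) w = hecke_col x m (hecke_op i a b F) w.
Proof.
elim: m w => //= m IH w mi; rewrite -hopC //.
by apply: eq_hecke_op => {}w; rewrite IH // ltnW.
Qed.

Definition transp (x : nat -> R) i j :=
  if j == i then x i.+1 else if j == i.+1 then x i else x j.

(** Braiding moves the operator through the factors of rows [i] and [i.+1], which exchange their
    variables; it commutes with all other factors. *)
Lemma hecke_op_hecke_col x m i F w : (i.+1 < m)%N -> (m < size w)%N -> uniq w ->
  hecke_op i (1 - x i) (x i.+1 - x i) (hecke_col x m F) w =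
  hecke_col (transp x i) m (hecke_op i.+1 (1 - x i) (x i.+1 - x i) F) w.
Proof.
elim: m w => // m IH w; rewrite ltnS leq_eqVlt => /predU1P[<-|im] sw uw.
  rewrite /= hecke_op_braid //.
  have -> : transp x i i.+1 = x i by rewrite /transp eqxx; case: eqP => //; lia.
  have -> : transp x i i = x i.+1 by rewrite /transp eqxx.
  apply: eq_hecke_op => {sw uw}w; apply: eq_hecke_op => {}w.
  rewrite hcolC //; apply: eq_hecke_col_var => j ji; rewrite /transp.
  by case: eqP => [|_]; [lia|case: eqP => //; lia].
rewrite /= hopC //.
have -> : transp x i m = x m.
  by rewrite /transp; case: eqP => [|_]; [lia|case: eqP => //; lia].
by apply: eq_hecke_op_at; rewrite IH ?size_swap_at ?uniq_swap_at // ltnW.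
Qed.

(** Selects the words whose least letter has reached the front; the later columns act on the
    tail. *)
Definition lift_head F : seq nat -> R := fun z =>
  if z is a :: t then if all (ltn a) t then F t else 0 else 0.

(* [hecke_col x m] adds to a pipe dream on columns [2, 3, ...] its first column: the
   cell of row [i] contributes a factor [1 + x_i u_(i+1)] of the 0-Hecke algebra. *)
Fixpoint pipe_poly (x : nat -> R) (n : nat) : seq nat -> R :=
  if n is n'.+1 then hecke_col x n' (lift_head (pipe_poly x n')) else fun=> 1.

Lemma eq_pipe_poly x y n : (forall i, (i.+1 < n)%N -> x i = y i) ->
  pipe_poly x n =1 pipe_poly y n.
Proof.
elim: n => // n IH e w /=; rewrite (eq_hecke_col_var (y := y)); last first.
  by move=> i im; apply: e.
apply: eq_hecke_col => -[|a t] //=; case: ifP => // _; apply: IH => i im.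
by apply: e; rewrite ltnW.
Qed.

Lemma hecke_op_lift_head i a b F c t :
  hecke_op i.+1 a b (lift_head F) (c :: t) = if all (ltn c) t then hecke_op i a b F t else 0.
Proof.
rewrite /hecke_op /= (perm_all _ (perm_swap_at i t)); case: ifP => // _.
by case: ifP => _; ring.
Qed.

Lemma hecke_col_scale x m k F w : hecke_col x m (fun s => k * F s) w = k * hecke_col x m F w.
Proof.
elim: m w => //= m IH w; rewrite (eq_hecke_op _ _ _ IH).
by rewrite /hecke_op; case: ifP => _; ring.
Qed.

(** Each factor moves the least letter by at most one place. Hence [k] factors cannot bring it to
    the front from beyond position [k], and from position [k] they do so only if all of them are
    crosses. *)
Lemma hecke_col_min x k F (t1 t2 : seq nat) a : (forall z, F z != 0 -> 
    if z is c :: t then all (ltn c) t else true) ->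
  all (ltn a) (t1 ++ t2) ->
  ((k < size t1)%N -> hecke_col x k F (t1 ++ a :: t2) = 0) /\
  (k = size t1 ->
    hecke_col x k F (t1 ++ a :: t2) = \prod_(i < k) x i * F (a :: t1 ++ t2)).
Proof.
move=> F0; elim: k t1 t2 => [|k IH] t1 t2 amin.
  split; last by case: t1 {amin} => // _; rewrite big_ord0 mul1r.
  case: t1 amin => //= c t1 /andP[ac _] _; apply: contraTeq isT => /F0.
  by rewrite all_cat => /and3P[_ /= ca]; move: ac ca => /=; lia.
split=> sk /=.
  rewrite /hecke_op (proj1 (IH _ _ amin)) ?(ltnW sk) //.
  have -> : swap_at k (t1 ++ a :: t2) = swap_at k t1 ++ a :: t2.
    elim: (k) t1 sk {IH amin} => [|k' IHk] [|p t1] //=; last by move=> /IHk ->.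
    by case: t1.
  rewrite (proj1 (IH _ _ _)) ?size_swap_at ?(ltnW sk) //.
    by case: ifP => _; ring.
  by rewrite all_cat (perm_all _ (perm_swap_at k t1)) -all_cat.
case/lastP: t1 sk amin => // t1 b; rewrite size_rcons => -[ek] amin; subst k.
have [e0 _] := IH _ _ amin; rewrite /hecke_op e0 ?size_rcons //.
have := amin; rewrite cat_rcons => /[dup] amin'.
rewrite all_cat => /andP[_ /andP[/= ab _]].
have -> : descent_at (size t1) (rcons t1 b ++ a :: t2).
  by rewrite cat_rcons; elim: (t1).
have -> : swap_at (size t1) (rcons t1 b ++ a :: t2) = t1 ++ a :: b :: t2.
  by rewrite cat_rcons; elim: (t1) => //= p t ->.
rewrite (proj2 (IH t1 (b :: t2) amin')) // big_ord_recr /=; ring.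
Qed.

(** In a decreasing word the least letter comes last, so every column consists of crosses. *)
Lemma pipe_poly_decr x (w : seq nat) : sorted gtn w ->
  pipe_poly x (size w) w = \prod_(i < size w) x i ^+ (size w - i.+1).
Proof.
elim/last_ind: w => [|w a IH]; first by rewrite big_ord0.
move=> sw; have aw : all (ltn a) w.
  have : sorted ltn (rev (rcons w a)) by rewrite rev_sorted.
  by rewrite rev_rcons /= (path_sortedE ltn_trans) all_rev => /andP[].
have tg : transitive gtn by move=> p q r /= qp pr; apply: ltn_trans qp.
have {}IH := IH (subseq_sorted tg (subseq_rcons w a) sw).
rewrite size_rcons /= -cats1.
rewrite (proj2 (@hecke_col_min x (size w) (lift_head (pipe_poly x (size w))) w [::] a _ _)) ?cats0 //; last first.
  by case=> [|c t] //=; case: ifP => //; rewrite eqxx.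
rewrite /= aw IH -big_split big_ord_recr /= subnn expr0 mulr1.
apply: eq_bigr => i _; rewrite -exprS; congr (_ ^+ _).
by have := ltn_ord i; lia.
Qed.

End Hecke.

(** * The divided difference recursion for [pipe_poly] *)

Section HeckeMorphism.
Import GRing.Theory.
Local Open Scope ring_scope.
Variables (R : comPzRingType) (s : {rmorphism R -> R}) (x : nat -> R).

Lemma hecke_col_morph m (F : seq nat -> R) w :
  s (hecke_col x m F w) = hecke_col (fun i => s (x i)) m (fun z => s (F z)) w.
Proof.
elim: m w => //= m IH w; rewrite /hecke_op rmorphD rmorphM rmorph1 !IH.
by case: ifP => _; rewrite ?rmorph0 // rmorphM rmorphB !IH.
Qed.

Lemma pipe_poly_morph n w : s (pipe_poly x n w) = pipe_poly (fun i => s (x i)) n w.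
Proof.
elim: n w => [|n IH] w /=; first by rewrite rmorph1.
rewrite hecke_col_morph; apply: eq_hecke_col => -[|a t] /=;
  first by rewrite rmorph0.
by case: ifP => _; rewrite ?rmorph0.
Qed.

(** At a descent this is the Grothendieck recursion with its denominator cleared. The operator
    either merges with the last factor of the first column, the later columns being free of [x i]
    and [x i.+1], or moves past that column to the induction hypothesis. *)
Lemma hecke_op_pipe_poly i n w : (forall j, s (x j) = transp x i j) ->
  (i.+1 < n)%N -> size w = n -> uniq w ->
  hecke_op i (1 - x i) (x i.+1 - x i) (pipe_poly x n) w = (1 - x i) * s (pipe_poly x n w).
Proof.
move=> sx; elim: n w => // n IH w lt_in sw uw.
rewrite ltnS leq_eqVlt in lt_in; case/predU1P: lt_in => [en|lt_in] /=.
  subst n; rewrite hecke_op_merge; congr (_ * _); rewrite hecke_col_morph /=.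
  rewrite sx /transp eqxx; apply: eq_hecke_op => z.
  transitivity (hecke_col (fun j => s (x j)) i (lift_head (pipe_poly x i.+1)) z).
    apply: eq_hecke_col_var => j ji; rewrite sx /transp.
    by case: eqP => [|_]; [lia|case: eqP => //; lia].
  apply: eq_hecke_col => -[|a t]; rewrite /lift_head ?rmorph0 //.
  case: ifP => _; rewrite ?rmorph0 // pipe_poly_morph;
    apply: eq_pipe_poly => j ji.
  by rewrite sx /transp; case: eqP => [|_]; [lia|case: eqP => //; lia].
rewrite hecke_op_hecke_col //; last by rewrite sw.
rewrite hecke_col_morph -hecke_col_scale -(@eq_hecke_col_var _ (transp x i));
  last first.
  by move=> j _; rewrite sx.
apply: eq_hecke_col_on uw => z; rewrite sw.
case: z => // a t [st] /andP[_ ut]; rewrite hecke_op_lift_head /=.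
by case: ifP => _; [rewrite IH|rewrite rmorph0 mulr0].
Qed.

End HeckeMorphism.

(* Values are shifted by one so that [lis 0] is the length of a longest
   increasing subsequence of the whole word. *)
Definition word n (w : 'S_n) : seq nat := [seq (w i).+1 | i <- enum 'I_n].

Definition xvar n (i : nat) : {mpoly int[n]} :=
  if insub i is Some j then 'X_(j : 'I_n) else 0.

Lemma xvar_ord n (i : 'I_n) : xvar n i = 'X_i.
Proof. by rewrite /xvar valK. Qed.

Lemma size_word n (w : 'S_n) : size (word w) = n.
Proof. by rewrite size_map size_enum_ord. Qed.

Lemma nth_word n (w : 'S_n) (i : 'I_n) : nth 0 (word w) i = (w i).+1.
Proof. by rewrite (nth_map i) ?size_enum_ord // nth_ord_enum. Qed.

Lemma uniq_word n (w : 'S_n) : uniq (word w).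
Proof. by rewrite map_inj_uniq ?enum_uniq // => i j [/val_inj/perm_inj]. Qed.

Lemma word_gt0 n (w : 'S_n) : 0 \notin word w.
Proof. by apply/negP => /mapP[]. Qed.

Lemma nth_swap_at i w k : i.+1 < size w -> nth 0 (swap_at i w) k =
  if k == i then nth 0 w i.+1 else if k == i.+1 then nth 0 w i else nth 0 w k.
Proof.
elim: i w k => [|i IH] [|a w] k //; last by case: k => [|k] //=; apply: IH.
by case: w => // b w _; case: k => [|[|k]].
Qed.

Lemma descent_at_nth i w : i.+1 < size w ->
  descent_at i w = (nth 0 w i.+1 < nth 0 w i).
Proof. by elim: i w => [|i IH] [|a [|b w]] //= iw; rewrite IH. Qed.

(** * Grothendieck polynomials as pipe dream polynomials *)

Section GrothendieckWord.
Import GRing.Theory.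
Variable n : nat.
Implicit Types (i j : 'I_n) (w : 'S_n).

Lemma swap_at_word w i j : j = i.+1 :> nat ->
  swap_at i (word w) = word (tperm i j * w)%g.
Proof.
move=> ij; have lt_in : i.+1 < size (word w) by rewrite size_word -ij.
apply: (@eq_from_nth _ 0); rewrite size_swap_at ?size_word // => k kn.
rewrite nth_swap_at // -[k]/(val (Ordinal kn)); move: (Ordinal kn) => {kn}k.
rewrite -ij !nth_word permM !val_eqE.
by case: tpermP => [->|->|/eqP/negbTE-> /eqP/negbTE->//]; rewrite eqxx //;
   case: eqP => [->|].
Qed.

Lemma descent_at_word w i j : j = i.+1 :> nat ->
  descent_at i (word w) = (w j < w i).
Proof. by move=> ij; rewrite descent_at_nth ?size_word -?ij // !nth_word. Qed.

Lemma msym_xvar i j k : j = i.+1 :> nat ->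
  msym (tperm i j) (xvar n k) = transp (xvar n) i k.
Proof.
move=> ij; rewrite /transp -ij; have [kn|nk] := ltnP k n; last first.
  have xk0 : xvar n k = 0%R by rewrite /xvar insubN // -leqNgt.
  rewrite xk0 msym0; have := ltn_ord i; have := ltn_ord j.
  by case: eqP => [<-|_]; [lia|case: eqP => [<-|//]; lia].
rewrite -[k]/(val (Ordinal kn)); move: (Ordinal kn) => {kn}k.
rewrite !xvar_ord msym_var !val_eqE.
by case: tpermP => [->|->|/eqP/negbTE-> /eqP/negbTE->//]; rewrite eqxx //;
   case: eqP => [->|].
Qed.

Lemma word_w0 : sorted gtn (word (w0 n)).
Proof.
have tg : transitive gtn by move=> p q r /= qp pr; apply: ltn_trans qp.
rewrite sorted_pairwise // pairwise_map.
have: pairwise ltn [seq val i | i <- enum 'I_n].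
  by rewrite val_enum_ord -sorted_pairwise ?iota_ltn_sorted //;
    apply: ltn_trans.
rewrite pairwise_map; apply: sub_pairwise => i j /=; rewrite !permE /=.
by have := ltn_ord i; have := ltn_ord j; lia.
Qed.

Lemma groth_pipe_poly w f : groth w f -> f = pipe_poly (xvar n) n (word w).
Proof.
elim=> {w f} [|w f i j ij desc _ ->].
  rewrite -[n in pipe_poly _ n](size_word (w0 n)) pipe_poly_decr ?word_w0 // size_word.
  by apply: eq_bigr => i _; rewrite xvar_ord.
have lt_in : i.+1 < n by rewrite -ij.
have Xneq : ('X_i - 'X_j != 0 :> {mpoly int[n]})%R.
  rewrite subr_eq0; apply/eqP => /(congr1 (mcoeff U_(i))).
  rewrite !mcoeffX eqxx; case: eqP => // /(congr1 (fun m : 'X_{1..n} => m i)).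
  by rewrite !mnm1E eqxx -val_eqE /= ij; case: eqP => // /esym/n_Sn.
apply: (mulfI Xneq); rewrite ddiffP -(swap_at_word w ij).
have := @hecke_op_pipe_poly _ (msym (tperm i j)) (xvar n) i n (word w)
  (fun k => msym_xvar k ij) lt_in (size_word w) (uniq_word w).
rewrite /hecke_op (descent_at_word w ij) desc -ij !xvar_ord => e.
rewrite msymM msymB msym1 msym_var tpermR -e; ring.
Qed.

End GrothendieckWord.

(** * Degrees *)

Fixpoint inv_word (s : seq nat) : nat :=
  if s is a :: t then count (fun b => b < a) t + inv_word t else 0.

Section Alternating.
Import Order.TTheory GRing.Theory Num.Theory.
Variable n : nat.
Local Open Scope ring_scope.
Implicit Types p q : {mpoly int[n]}.

(* Each homogeneous component of [p], of degree [d] say, is [(-1)^(e + d)] times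
   a polynomial with nonnegative coefficients. *)
Definition alternating (e : nat) p : Prop :=
  forall m, 0 <= (-1) ^+ (e + mdeg m) * p@_m.

Lemma alternating_odd e e' p :
  odd e = odd e' -> alternating e p -> alternating e' p.
Proof.
by move=> oe ap m; have := ap m; rewrite -signr_odd -[X in _ ->
  _ <= X * _]signr_odd !oddD oe.
Qed.

Lemma alternating0 e : alternating e 0.
Proof. by move=> m; rewrite mcoeff0 mulr0. Qed.

Lemma alternatingD e p q :
  alternating e p -> alternating e q -> alternating e (p + q).
Proof. by move=> ap aq m; rewrite mcoeffD mulrDr addr_ge0. Qed.

Lemma alternatingN e p : alternating e.+1 p -> alternating e (- p).
Proof.
by move=> ap m; have := ap m; rewrite addSn exprS mcoeffN mulrN mulN1r mulNr.
Qed.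

Lemma alternatingX e p i : alternating e.+1 p -> alternating e ('X_i * p).
Proof.
move=> ap m; rewrite ['X_i * p]mulrC; have [|im] :=
  boolP (m \in msupp (p * 'X_i)).
  rewrite (perm_mem (msuppMX p U_(i))) => /mapP[m' _ ->].
  by rewrite mcoeffMX mdegD mdeg1 add1n addnS -addSn.
by rewrite (memN_msupp_eq0 im) mulr0.
Qed.

(** Coefficients of the same monomial agree in sign, so nothing cancels. *)
Lemma alternating_msizeD e p q : alternating e p -> alternating e q ->
  msize (p + q) = maxn (msize p) (msize q).
Proof.
move=> ap aq; apply/eqP; rewrite eqn_leq msizeD_le /=.
suff h p' q' : alternating e p' -> alternating e q' ->
    (msize p' <= msize (p' + q'))%N.
  by rewrite geq_max h //= addrC h.
move=> {}ap {}aq; rewrite [X in (X <= _)%N]msizeE;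
  apply/bigmax_leqP_seq => m mp _.
apply: msize_mdeg_lt; rewrite mcoeff_msupp mcoeffD; rewrite mcoeff_msupp in mp.
apply: contraNneq mp => e0.
have := paddr_eq0 (ap m) (aq m); rewrite -mulrDr e0 mulr0 eqxx => /esym/andP[].
by rewrite mulf_eq0 signr_eq0.
Qed.

Lemma msizeXM i p : msize ('X_i * p) = if p == 0 then 0%N else (msize p).+1.
Proof.
case: eqP => [->|/eqP p0]; first by rewrite mulr0 msize0.
by rewrite msizeM // ?msizeX ?mdeg1 // -msize_poly_eq0 msizeX.
Qed.

(** Exchanging the letters, multiplying by ['X_i] and negating each flip the expected sign. Both new
    terms undergo two flips, so no cancellation occurs. *)
Lemma hecke_op_alternating x F a d t e i : x = 'X_i :> {mpoly int[n]} ->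
  alternating (e + inv_word [:: a, d & t]) (F [:: a, d & t]) ->
  alternating (e + inv_word [:: d, a & t]) (F [:: d, a & t]) ->
  alternating (e + inv_word [:: a, d & t]) (hecke_op 0 1 x F [:: a, d & t]) /\
  msize (hecke_op 0 1 x F [:: a, d & t]) =
    if (d < a)%N then maxn (msize ('X_i * F [:: a, d & t]))
                           (msize ('X_i * F [:: d, a & t]))
    else msize (F [:: a, d & t]).
Proof.
move=> -> a1 a2.
have -> : hecke_op 0 1 'X_i F [:: a, d & t] = F [:: a, d & t] +
    if (d < a)%N then 'X_i * (F [:: d, a & t] - F [:: a, d & t]) else 0.
  by rewrite /hecke_op mul1r.
have [da|_] := ifPn; last by rewrite addr0.
set p1 := F [:: a, _ & _] in a1 *; set p2 := F _ in a2 *.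
set E := (e + inv_word [:: a, d & t])%N in a1 *.
have a3 : alternating E ('X_i * p2).
  apply: alternatingX; apply: alternating_odd a2.
  by rewrite /E /= da; have -> : (a < d)%N = false by [lia]; lia.
have a4 : alternating E (- ('X_i * p1)).
  by apply/alternatingN/alternatingX/alternating_odd/a1; rewrite /= negbK.
have a5 := alternatingD a3 a4.
rewrite mulrBr; split; first exact: alternatingD.
rewrite (alternating_msizeD a1 a5) (alternating_msizeD a3 a4) msizeN !msizeXM.
have p0 p : p == 0 -> msize p = 0%N by move/eqP->; rewrite msize0.
move: (p0 p1) (p0 p2).
by case: (p1 == 0); case: (p2 == 0); lia.
Qed.

(** Without cancellation the degree is a maximum over passes, each having [m.+1 - b] crosses; the
    last two clauses express it as a least upper bound. In the induction [e] absorbs the inversions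
    of the letter peeled off the front. *)
Lemma hecke_col_alternating m (x : nat -> {mpoly int[n]})
    (F : seq nat -> {mpoly int[n]}) e (w : seq nat) : size w = m.+1 ->
  (forall i, (i < m)%N -> exists j, x i = 'X_j) ->
  (forall u, perm_eq u w -> alternating (e + inv_word u) (F u)) ->
  alternating (e + inv_word w) (hecke_col x m F w) /\
  (forall K,
    (forall u b, pass u b w -> F u != 0 -> (msize (F u) + m.+1 <= K + b)%N) ->
    (msize (hecke_col x m F w) <= K)%N) /\
  (forall u b, pass u b w -> F u != 0 ->
    (msize (F u) + m.+1 <= msize (hecke_col x m F w) + b)%N).
Proof.
elim: m x F e w => [|m IH] x F e [|a w] // [sw] xv aF.
  case: w sw aF => // _ aF; split; first exact: (aF [:: a]).
  split=> [K /(_ _ _ (pass_end a)) h|u b pu F0].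
    have [e0|/h] := eqVneq (F [:: a]) 0; first by rewrite /= e0 msize0.
    by rewrite !addn1 ltnS.
  have -> : u = [:: a] by apply: perm_small_eq (pass_perm pu).
  by rewrite /= leq_add2l (pass_gt0 pu).
rewrite hecke_col_head; set x' := fun i => _; set H := fun s => _.
have [i0 xi0] := xv 0%N isT.
have HP (d : nat) (t : seq nat) : perm_eq (d :: t) w ->
    alternating (e + inv_word [:: a, d & t]) (H (d :: t)) /\
    msize (H (d :: t)) =
    if (d < a)%N then maxn (msize ('X_i0 * F [:: a, d & t]))
                           (msize ('X_i0 * F [:: d, a & t]))
    else msize (F [:: a, d & t]).
  move=> pw; apply: hecke_op_alternating => //; apply: aF;
    first by rewrite perm_cons.
  rewrite -(perm_cons a) in pw; apply: perm_trans pw.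
  exact: (perm_swap_at 0 [:: a, d & t]).
have [] := IH x' H (e + count (fun b => (b < a)%N) w)%N w sw.
- by move=> i im; apply: xv.
- move=> [|d t] pu; first by move/perm_size: pu; rewrite sw.
  rewrite -addnA -(seq.permP pu).
  by have [] := HP d t pu.
rewrite -addnA => al [ub lb]; split=> //; split=> [K hK|u b pu].
  apply: ub => -[|d t] c pc; first by move/pass_perm/perm_size: pc; rewrite sw.
  have [_] := HP d t (pass_perm pc).
  have k1 := hK _ _ (pass_skip a pc).
  case: ifP => da eH H0; last first.
    have : F [:: a, d & t] != 0 by rewrite -msize_poly_eq0 -eH msize_poly_eq0.
    by move/k1; rewrite !addnS ltnS -eH.
  have k2 := hK _ _ (pass_stay da pc).
  have k3 := hK _ _ (pass_swap da pc).
  move: H0 k1 k2 k3; rewrite -(msize_poly_eq0 (H _)) eH !msizeXM.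
  case: (F [:: a, d & t] == 0); case: (F [:: d, a & t] == 0) => //= _.
  - by move=> _ _ /(_ isT); rewrite max0n !addnS addSn.
  - by move=> _ /(_ isT) h _; rewrite maxn0; move: h; rewrite !addnS addSn.
  - move=> _ /(_ isT) + /(_ isT) => h1 h2.
    by rewrite /maxn; case: ifP => _; rewrite addSn -addnS.
have wn : w != [::] by case: (w) sw.
have [d [t [c [pc cases]]]] := pass_consE pu wn; move=> F0.
have [_ eH] := HP d t (pass_perm pc); have := lb _ _ pc.
rewrite -msize_poly_eq0 eH !msizeXM {eH}.
case: cases F0 => [[-> ->]|[da -> ->]|[da -> ->]] F0;
  have S0 := F0; rewrite -msize_poly_eq0 in S0; rewrite (negbTE F0) ?da.
- case: (d < a)%N => [h|/(_ S0)]; last by rewrite !addnS ltnS.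
  rewrite !addnS ltnS (leq_trans _ (h _)) //; last by rewrite -lt0n leq_max.
  by rewrite -addnS leq_add2r (leq_trans _ (leq_maxl _ _)).
- move=> h; rewrite -addSnnS (leq_trans _ (h _)) //;
  last by rewrite -lt0n leq_max.
  by rewrite leq_add2r leq_maxl.
- move=> h; rewrite -addSnnS (leq_trans _ (h _)) //;
  last by rewrite -lt0n leq_max orbT.
  by rewrite leq_add2r leq_maxr.
Qed.

(** Column by column, [pass_lsum] gives the upper bound and [pass_exists_min] attains it. A least
    head is in no inversion, so [lift_head] preserves the signs. *)
Lemma pipe_poly_alternating m (x : nat ->
  {mpoly int[n]}) (w : seq nat) : size w = m ->
  (forall i, (i.+1 < m)%N -> exists j, x i = 'X_j) -> uniq w -> 0%N \notin w ->
  alternating (inv_word w) (pipe_poly x m w) /\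
  (msize (pipe_poly x m w) + lsum w = 'C(m.+1, 2).+1)%N.
Proof.
elim: m w => [|m IH] w.
  move/size0nil=> -> *; rewrite /= msize1; split=> // k.
  by rewrite mcoeff1; case: eqP => [->|_]; rewrite ?mulr0 // mdeg0 expr0.
move=> sw xv uw w0.
have IH' t : size t = m -> uniq t -> 0%N \notin t ->
  alternating (inv_word t) (pipe_poly x m t) /\
    (msize (pipe_poly x m t) + lsum t = 'C(m.+1, 2).+1)%N.
  by move=> st ut t0; apply: IH => // i im; apply: xv; rewrite ltnW.
have inv_min a t : all (ltn a) t -> inv_word (a :: t) = inv_word t.
  move=> am /=; rewrite (eq_in_count (a2 :=
    pred0)) ?count_pred0 // => b /(allP am) /=; lia.
have [] := @hecke_col_alternating m x (lift_head (pipe_poly x m)) 0 w sw.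
- by move=> i im; apply: xv.
- case=> [|a t] pu; first exact: alternating0.
  rewrite /lift_head; case: ifP => am; last exact: alternating0.
  rewrite add0n inv_min //;
    move: (perm_size pu) (perm_uniq pu) (perm_mem pu 0%N).
  rewrite sw uw (negbTE w0) inE /= => -[st] /andP[_ ut] /norP[_ t0].
  by have [] := IH' t st ut t0.
rewrite add0n -[hecke_col x m _ w]/(pipe_poly x m.+1 w);
  move: (pipe_poly x m.+1 w) => G al [ub lb].
split=> //; have wn : w != [::] by case: (w) sw.
have msz u b : pass u b w -> lift_head (pipe_poly x m) u != 0 ->
    (msize (lift_head (pipe_poly x m) u) + lsum (behead u) = 'C(m.+1, 2).+1)%N.
  move/pass_perm => pu; case: u pu => [|a t] pu; first by rewrite /= eqxx.
  rewrite /lift_head; case: ifP => am; rewrite ?eqxx // => _.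
  move: (perm_size pu) (perm_uniq pu) (perm_mem pu 0%N).
  rewrite sw uw (negbTE w0) inE /= => -[st] /andP[_ ut] /norP[_ t0].
  by have [] := IH' t st ut t0.
have [c [t [b [pw am e _]]]] := pass_exists_min wn uw w0.
have nz : lift_head (pipe_poly x m) (c :: t) != 0.
  rewrite /lift_head am -msize_poly_eq0.
  move: (perm_size (pass_perm pw)) (perm_uniq (pass_perm pw)).
  move: (perm_mem (pass_perm pw) 0%N).
  rewrite sw uw (negbTE w0) inE /= => /norP[_ t0] [st] /andP[_ ut].
  have [_] := IH' t st ut t0; have := lsum_size t; rewrite st; lia.
have binE : 'C(m.+2, 2) = ('C(m.+1, 2) + m.+1)%N by rewrite binS bin1.
have lw := lsum_size w; rewrite sw in lw.
have k1 := lb _ _ pw nz; have k2 := msz _ _ pw nz; rewrite [behead _]/= in k2.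
have := ub ('C(m.+2, 2).+1 - lsum w)%N.
suff h u b' : pass u b' w -> lift_head (pipe_poly x m) u != 0 ->
    (msize (lift_head (pipe_poly x m) u) + m.+1 <= 'C(m.+2, 2).+1 - lsum w + b')%N.
  move=> /(_ h); move: (msize G) (msize (lift_head _ _)) k1 k2 => M1 M2; lia.
move=> pu nu; have := msz _ _ pu nu; have [_] := pass_lsum pu.
move: (msize (lift_head _ _)) => M1; lia.
Qed.

End Alternating.

(** * Inversions of vexillary permutations *)

Lemma onto_initial_segment (T : finType) (A : {set T}) (f : T -> nat) :
  {in A &, injective f} -> (forall x, x \in A -> f x < #|A|) ->
  forall a, a < #|A| -> exists2 x, x \in A & f x = a.
Proof.
move=> f_inj f_lt a aA; pose g x : 'I_#|A| := insubd (Ordinal aA) (f x).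
have gE x : x \in A -> g x = f x :> nat by move=> xA; rewrite val_insubd f_lt.
have : g @: A = [set: 'I_#|A|].
  apply/eqP; rewrite eqEcard subsetT cardsT card_ord card_in_imset ?leqnn // => x y xA yA.
  by move/(congr1 val); rewrite /= !gE //; apply: f_inj.
move/setP/(_ (Ordinal aA)); rewrite inE => /imsetP[x xA /(congr1 val) /= ->].
by exists x => //; rewrite gE.
Qed.

Lemma card_bounded (T : finType) (A : {set T}) (f : T -> nat) b :
  {in A &, injective f} -> (forall x, x \in A -> f x < b) -> #|A| <= b.
Proof.
move=> f_inj f_lt; rewrite -(size_iota 0 b) cardE -(size_map f).
apply: uniq_leq_size.
  by rewrite map_inj_in_uniq ?enum_uniq // => x y; rewrite !mem_enum;
    apply: f_inj.
by move=> y /mapP[x]; rewrite mem_enum mem_iota => /f_lt + ->.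
Qed.

Lemma rank_lt (T : finType) (A : {set T}) (f : T -> nat) x y :
  x \in A -> f x < f y ->
  #|[set z in A | f z < f x]| < #|[set z in A | f z < f y]|.
Proof.
move=> xA xy; apply/proper_card/properP; split.
  by apply/subsetP => z; rewrite !inE => /andP[->] /ltn_trans ->.
by exists x; rewrite !inE ?xA ?ltnn.
Qed.

Lemma rank_onto (T : finType) (A : {set T}) (f : T -> nat) :
  {in A &, injective f} -> forall a, a < #|A| ->
  exists2 x, x \in A & #|[set z in A | f z < f x]| = a.
Proof.
move=> f_inj; apply: onto_initial_segment => [x y xA yA e|x xA].
  apply: f_inj => //; case: (ltngtP (f x) (f y)) => // h.
    by have := rank_lt xA h; rewrite e ltnn.
  by have := rank_lt yA h; rewrite e ltnn.
apply/proper_card/properP; split; first by apply/subsetP => z;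
  rewrite inE => /andP[].
by exists x; rewrite ?inE ?ltnn ?andbF.
Qed.

Section Inversions.
Variables (n : nat) (v : 'S_n).
Implicit Types (i j k l p q x y z : 'I_n) (W I : {set 'I_n}) (c d : 'I_n * 'I_n)
  (Q : {set 'I_n * 'I_n}).

Definition invs W : {set 'I_n * 'I_n} :=
  [set c | [&& c.1 \in W, c.2 \in W, c.1 < c.2 & v c.2 < v c.1]].

(* The inversion [(p, x)] stands for the cell [(p, v x)] of the Rothe diagram.
   [cidx] and [ridx] count the cells of the diagram of the pattern of [v] on [W]
   that precede this cell in its column and in its row; for a vexillary [v] they
   are the coordinates of the corresponding cell of the shape. *)
Definition cidx W c : nat := #|[set z in W | (z < c.1) && (v c.2 < v z)]|.
Definition ridx W c : nat := #|[set z in W | (c.1 < z) && (v z < v c.2)]|.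

Definition below W p : {set 'I_n} := [set z in W | (p < z) && (v z < v p)].
(** A column length of the partition whose row lengths are the numbers [#|below W p|]. *)
Definition height W a : nat := #|[set p in W | a < #|below W p|]|.

Lemma vneq p q : p != q -> (v p != v q :> nat).
Proof. by apply: contra => /eqP/val_inj/perm_inj/eqP. Qed.

Lemma v_ltP p q : p < q -> ~~ (v p < v q) -> v q < v p.
Proof.
move=> pq; rewrite -leqNgt leq_eqVlt => /predU1P[/val_inj/perm_inj e|//].
by rewrite e ltnn in pq.
Qed.

Lemma invsP W c : c \in invs W ->
  [/\ c.1 \in W, c.2 \in W, c.1 < c.2 & v c.2 < v c.1].
Proof. by rewrite inE => /and4P[]. Qed.

Lemma ridx_below W c : c \in invs W ->
  ridx W c = #|[set z in below W c.1 | v z < v c.2]|.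
Proof.
case/invsP => c1 c2 lt1 lt2; apply: eq_card => z; rewrite !inE.
by case: (z \in W) => //=; case: (c.1 < z) => //=; case: ltnP; lia.
Qed.

Lemma invs_below W p x : p \in W -> ((p, x) \in invs W) = (x \in below W p).
Proof. by move=> pW; rewrite !inE pW. Qed.

Lemma ridx_inj W p x y : (p, x) \in invs W -> (p, y) \in invs W ->
  v x < v y -> ridx W (p, x) < ridx W (p, y).
Proof.
move=> cx cy xy; rewrite !ridx_below //=; apply: (rank_lt (f :=
  fun z => v z)) => //.
by rewrite -invs_below //; case/invsP: cx.
Qed.

Lemma ridx_onto W p a : p \in W -> a < #|below W p| ->
  exists2 x, (p, x) \in invs W & ridx W (p, x) = a.
Proof.
move=> pW; have v_inj : {in below W p &, injective (fun z => v z : nat)}.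
  by move=> x y _ _ /val_inj/perm_inj.
case/(rank_onto v_inj) => x xp e; rewrite -invs_below // in xp.
by exists x => //; rewrite ridx_below.
Qed.

Lemma ridx_lt W c : c \in invs W -> ridx W c < #|below W c.1|.
Proof.
move=> cW; rewrite ridx_below //; apply/proper_card/properP; split.
  by apply/subsetP => z; rewrite inE => /andP[].
exists c.2; last by rewrite !inE ltnn !andbF.
by case: c cW => p x cW; rewrite -invs_below //; case/invsP: cW.
Qed.

Lemma cidx_lt W c : c \in invs W -> cidx W c < height W (ridx W c).
Proof.
move=> cW; have [c1 c2 lt1 lt2] := invsP cW.
apply/proper_card/properP; split; last first.
  by exists c.1; rewrite !inE ?ltnn ?andbF // c1 ridx_lt.
apply/subsetP => z; rewrite !inE => /and3P[-> zc cz] /=.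
apply/proper_card/properP; split; last first.
  by exists c.2; rewrite !inE ?ltnn ?andbF // c2 cz (ltn_trans zc).
apply/subsetP => w; rewrite !inE => /and3P[-> cw wc] /=.
by rewrite (ltn_trans zc) //= (ltn_trans wc).
Qed.

Hypothesis vex : vexillary v.

Lemma vexP i j k l : i < j -> j < k -> k < l ->
  v j < v i -> v i < v l -> v l < v k -> False.
Proof. by move=> *; apply: vex; exists i, j, k, l. Qed.

(** The cell of [c] is strictly northwest of that of [d]. If some dot weakly above [c] lies between
    their columns, avoidance of 2143 puts every dot counted by [ridx W c] below row [d.1], and the
    row index grows; if there is none, the column index grows. *)
Lemma idx_lt W c d : c \in invs W -> d \in invs W -> c.1 < d.1 ->
  v c.2 < v d.2 ->
  cidx W c < cidx W d \/ ridx W c < ridx W d.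
Proof.
move=> /invsP[c1 c2 cl1 cl2] /invsP[d1 d2 dl1 dl2] lt1 lt2.
have [/existsP[z /and4P[zd zd' zc cz]]|/existsPn noz] := boolP [exists z : 'I_n,
  [&& z < d.1, v z < v d.2, z <= c.1 & v c.2 < v z]].
  have key y : c.1 < y -> v y <= v c.2 -> d.1 < y.
    move=> cy yc; rewrite ltnNge leq_eqVlt;
      apply/negP => /predU1P[/val_inj e|yd].
      by move: dl2; rewrite -e; lia.
    by apply: (@vexP z y d.1 d.2) => //; lia.
  right; apply/proper_card/properP; split.
    apply/subsetP => y; rewrite !inE => /and3P[-> cy yc] /=.
    by rewrite key ?(ltnW yc) //= (ltn_trans yc).
  by exists c.2; rewrite !inE ?ltnn ?andbF // c2 key //= lt2.
have key y : y <= c.1 -> v c.2 < v y -> v d.2 < v y.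
  move=> yc cy; have := noz y; rewrite yc cy !andbT negb_and.
  have -> /= : y < d.1 by lia.
  rewrite -leqNgt leq_eqVlt => /predU1P[/val_inj/perm_inj e|//].
  by move: dl1; rewrite e; lia.
left; apply/proper_card/properP; split.
  apply/subsetP => y; rewrite !inE => /and3P[-> yc cy] /=.
  by rewrite (ltn_trans yc) // key // ltnW.
by exists c.1; rewrite !inE ?ltnn ?andbF // c1 lt1 key.
Qed.

(** Witnesses [x] and [y] against the two inclusions would form 2143 together with [p] and [q]. *)
Lemma below_nested W p q :
  below W p \subset below W q \/ below W q \subset below W p.
Proof.
have [|/subsetPn[x]] := boolP (below W p \subset below W q); first by left.
rewrite !inE => /and3P[xW px xp];
  rewrite xW /= negb_and -leqNgt -[~~ _]leqNgt => nx.
right; apply/subsetP => y; rewrite !inE => /and3P[-> qy yq] /=.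
apply: contraT; rewrite negb_and -leqNgt -[~~ _]leqNgt => ny.
have pq : p != q by apply/eqP => e; move: px xp nx qy yq ny; rewrite e; lia.
have xy : x != y by apply/eqP => e; move: px xp nx qy yq ny; rewrite e; lia.
have xq : x != q by apply/eqP => e; move: px xp nx qy yq ny; rewrite e; lia.
have yp : y != p by apply/eqP => e; move: px xp nx qy yq ny; rewrite e; lia.
have := vneq pq; have := vneq xy; have := vneq xq; have := vneq yp.
move: pq xy xq yp; rewrite -!val_eqE /= => *; exfalso.
have [lt_pq|le_qp] := ltnP p q;
  [apply: (@vexP p x q y)|apply: (@vexP q y p x)] => //; lia.
Qed.

Lemma idx_inj W : {in invs W &, forall c d,
  cidx W c = cidx W d -> ridx W c = ridx W d -> c = d}.
Proof.
suff h c d : c \in invs W -> d \in invs W -> c.1 <= d.1 ->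
    cidx W c = cidx W d -> ridx W c = ridx W d -> c = d.
  by move=> c d cW dW e1 e2; case: (leqP c.1 d.1) => [|/ltnW] le; [|symmetry];
    apply: h.
move=> cW dW; have [c1 c2 cl1 cl2] := invsP cW; have [d1 d2 dl1 dl2] :=
  invsP dW.
rewrite leq_eqVlt => /predU1P[/val_inj e _ e2|lt1 e1 e2].
  case: c d e cW dW e2 {c1 c2 d1 d2 cl1 cl2 dl1 dl2} => p x [q y] /= <- cW dW e2.
  case: (ltngtP (v x) (v y)) => [lt|lt|/val_inj/perm_inj -> //].
    by have := ridx_inj cW dW lt; lia.
  by have := ridx_inj dW cW lt; lia.
have [lt|] := ltnP (v c.2) (v d.2); first by have := idx_lt cW dW lt1 lt; lia.
rewrite leq_eqVlt => /predU1P[/val_inj/perm_inj e|lt]; exfalso.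
  suff : cidx W c < cidx W d by lia.
  apply/proper_card/properP; split.
    apply/subsetP => y; rewrite !inE e => /and3P[-> yc ->] /=.
    by rewrite (ltn_trans yc).
  by exists c.1; rewrite !inE ?ltnn ?andbF // c1 lt1 e.
suff : ridx W d < ridx W c by lia.
apply/proper_card/properP; split.
  apply/subsetP => y; rewrite !inE => /and3P[-> dy yd] /=.
  by rewrite (ltn_trans lt1) // (ltn_trans yd).
by exists d.2; rewrite !inE ?ltnn ?andbF // d2 lt (ltn_trans lt1).
Qed.

(** Each of the [height W b] rows longer than [b] has a cell with row index [b]. Their column
    indices are distinct by [idx_inj] and smaller than [height W b], so they take all values. *)
Lemma idx_onto W a b : a < height W b ->
  exists2 c, c \in invs W & cidx W c = a /\ ridx W c = b.
Proof.
pose g p := odflt p [pick x | ((p, x) \in invs W) && (ridx W (p, x) == b)].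
have gP p : p \in [set p in W | b < #|below W p|] ->
    (p, g p) \in invs W /\ ridx W (p, g p) = b.
  rewrite inE /g => /andP[pW bp]; case: pickP => [x /andP[? /eqP]//|].
  by have [x xW /eqP e] := ridx_onto pW bp; move/(_ x); rewrite xW e.
case/(onto_initial_segment (f :=
  fun p => cidx W (p, g p))) => [p q pA qA e|p pA|p pA e].
- have [p1 p2] := gP p pA; have [q1 q2] := gP q qA.
  by case: (idx_inj p1 q1 e (etrans p2 (esym q2))).
- by have [p1 p2] := gP p pA;
  rewrite -/(height W b) -[X in height _ X]p2 cidx_lt.
- by have [p1 p2] := gP p pA; exists (p, g p).
Qed.

Definition increasing I : Prop := forall p q, p \in I -> q \in I -> p < q ->
  v p < v q.

Definition ad_step W c d : Prop := cidx W c < cidx W d /\ ridx W d < ridx W c.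

Definition antidiagonal W Q : Prop :=
  forall c d, c \in Q -> d \in Q -> c != d -> ad_step W c d \/ ad_step W d c.

(** At most [t] elements have row index below [t]; the others have distinct column indices below
    [height W t]. *)
Lemma antidiagonal_height W Q t : Q \subset invs W -> antidiagonal W Q ->
  #|Q| <= height W t + t.
Proof.
move=> /subsetP sQ aQ.
have [ltQ|] := ltnP t #|Q|; last by lia.
rewrite addnC -leq_subLR.
pose A := [set c in Q | t <= ridx W c].
have cA : #|Q| - t <= #|A|.
  rewrite leq_subLR -(cardsID A Q) addnC leq_add ?subset_leq_card ?subsetIr //.
  apply: (@card_bounded _ _ (ridx W)) => [c d|c].
    rewrite !inE => /andP[_ cQ] /andP[_ dQ] e; apply: contraTeq isT => cd.
    by case: (aQ _ _ cQ dQ cd) => -[_]; rewrite e ltnn.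
  by rewrite !inE negb_and -ltnNge => /andP[/orP[/negbTE->|]].
apply: leq_trans cA _; apply: (@card_bounded _ _ (cidx W)) => [c d|c].
  rewrite !inE => /andP[cQ _] /andP[dQ _] e; apply: contraTeq isT => cd.
  by case: (aQ _ _ cQ dQ cd) => -[]; rewrite e ltnn.
rewrite inE => /andP[cQ tc]; apply: leq_trans (cidx_lt (sQ _ cQ)) _.
apply: subset_leq_card; apply/subsetP => p; rewrite !inE => /andP[-> /=].
exact: leq_ltn_trans.
Qed.

End Inversions.

(** * Duality between antidiagonals and increasing sequences *)

Section Staircase.
Variables (n : nat) (v : 'S_n).
Implicit Types (i j k l p q x y z : 'I_n) (W I : {set 'I_n}) (c d : 'I_n * 'I_n)
  (Q : {set 'I_n * 'I_n}).

Lemma below_lt W p z : z \in below v W p -> #|below v W z| < #|below v W p|.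
Proof.
rewrite inE => /and3P[zW pz zp]; apply/proper_card/properP; split.
  apply/subsetP => y; rewrite !inE => /and3P[-> zy yz] /=.
  by rewrite (ltn_trans pz) // (ltn_trans yz).
by exists z; rewrite !inE ?ltnn ?andbF // zW pz.
Qed.

(** Let [p] in [I] have the longest row. The positions with longer rows, [I] and [below v W p] are
    disjoint in [W], and the first and third together have at least [#|Q|] elements by
    [antidiagonal_height]. *)
Lemma antidiagonal_increasing W Q I :
  Q \subset invs v W -> antidiagonal v W Q -> I \subset W -> increasing v I ->
  #|Q| + #|I| <= #|W|.
Proof.
move=> sQ aQ sI incI; have hQ t := antidiagonal_height t sQ aQ.
have [->|[p0 p0I]] := set_0Vmem I.
  rewrite cards0 addn0; apply: leq_trans (hQ 0) _.
  by rewrite addn0 subset_leq_card //; apply/subsetP => p;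
    rewrite inE => /andP[].
have [p pI pmax] := arg_maxnP (fun p => #|below v W p|) p0I.
have pW := subsetP sI _ pI.
pose S := [set z in W | #|below v W p| < #|below v W z|].
have dS : [disjoint S & I :|: below v W p].
  apply/pred0P => z /=; rewrite inE in_setU;
    apply/negbTE/negP => /andP[/andP[_ h1]].
  case/orP => [/pmax|/below_lt]; last by move/(ltn_trans h1); rewrite ltnn.
  by rewrite /geq /= leqNgt h1.
have dI : [disjoint I & below v W p].
  apply/pred0P => z /=; apply/negbTE/negP => /andP[zI];
    rewrite inE => /and3P[_ pz].
  by have := incI _ _ pI zI pz; lia.
have sW : S :|: (I :|: below v W p) \subset W.
  by rewrite !subUset sI; apply/andP; split; [|apply/andP; split=> //];
     apply/subsetP => z; rewrite inE => /andP[].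
have := subset_leq_card sW; have := hQ #|below v W p|.
rewrite -/S /height -/S !cardsU (disjoint_setI0 dS) (disjoint_setI0 dI) cards0.
lia.
Qed.

Hypothesis vex : vexillary v.

(** [Q] is the antidiagonal of the largest staircase in the shape. A column [t] obstructing the next
    staircase yields [I]: take the positions with rows of length at most [t] and discard the at most
    [t] elements of [below v W p], where [p] has the longest of these rows. *)
Lemma antidiagonal_exists W : exists Q I,
  [/\ Q \subset invs v W, antidiagonal v W Q, I \subset W, increasing v I
    & #|W| <= #|Q| + #|I|].
Proof.
(* [P m] says that the staircase with column heights [m, ..., 1] fits into the shape. *)
pose P m := [forall t : 'I_m, m <= height v W t + t].
have P0 : P 0 by apply/forallP => -[].
have Pb m : P m -> m <= #|W|.
  case: m => // m /forallP/(_ ord0); rewrite addn0 => /leq_trans; apply.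
  by apply: subset_leq_card; apply/subsetP => p; rewrite inE => /andP[].
have [m /forallP Pm mmax] := @ex_maxnP P _ (ex_intro _ 0 P0) Pb.
have /forallPn[t] : ~~ P m.+1 by apply/negP => /mmax; rewrite ltnn.
rewrite -ltnNge => ht.
have exc (s : 'I_m) : exists c, (c \in invs v W) &&
    ((cidx v W c == s) && (ridx v W c == m.-1 - s)).
  have lt_b : m.-1 - s < m by have := ltn_ord s; lia.
  have := Pm (Ordinal lt_b) => /= hb.
  have [|c cW [e1 e2]] := @idx_onto n v vex W s (m.-1 - s).
    by have := ltn_ord s; lia.
  by exists c; rewrite cW e1 e2 !eqxx.
pose g s := xchoose (exc s).
have gP s : [/\ g s \in invs v W, cidx v W (g s) = s & ridx v W (g s) = m.-1 - s].
  by have /and3P[? /eqP ? /eqP ?] := xchooseP (exc s).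
have g_inj : injective g.
  move=> s s' e; apply/val_inj => /=.
  by have [_ <- _] := gP s; have [_ <- _] := gP s'; rewrite e.
pose Q := [set g s | s : 'I_m].
have cQ : #|Q| = m by rewrite card_imset // card_ord.
have sQ : Q \subset invs v W by apply/subsetP => c /imsetP[s _ ->]; have [] :=
  gP s.
have aQ : antidiagonal v W Q.
  move=> c d /imsetP[s _ ->] /imsetP[s' _ ->] ss'; rewrite /ad_step.
  have [_ -> ->] := gP s; have [_ -> ->] := gP s'.
  have : (s : nat) != s' by apply: contraNneq ss' => /val_inj ->.
  by have := ltn_ord s; have := ltn_ord s'; lia.
pose Z := [set p in W | #|below v W p| <= t].
have cZ : #|W| = height v W t + #|Z|.
  rewrite -(cardsID [set p | t < #|below v W p|] W); congr (_ + _);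
    apply: eq_card => p.
    by rewrite !inE.
  by rewrite !inE -leqNgt andbC.
have sZ : Z \subset W by apply/subsetP => p; rewrite inE => /andP[].
have [Z0|[p0 p0Z]] := set_0Vmem Z.
  exists Q, set0; split=> //; first exact: sub0set.
    by move=> p q; rewrite inE.
  by rewrite cZ Z0 cards0 cQ; lia.
have [p pZ pmax] := arg_maxnP (fun p => #|below v W p|) p0Z.
exists Q, (Z :\: below v W p); split=> //.
- by rewrite subDset (subset_trans sZ) // subsetUr.
- move=> x y; rewrite !in_setD => /andP[xp xZ] /andP[yp yZ] xy.
  apply: contraT => /(v_ltP xy) yx.
  have yW := subsetP sZ _ yZ; have yD : y \in below v W x by rewrite inE yW xy.
  (* By nestedness an inversion inside [I] would make the row of [x] longer than that of [p]. *)
  have [/subsetP/(_ _ yD)|s] := below_nested vex W x p;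
    first by rewrite (negbTE yp).
  have : #|below v W p| < #|below v W x|.
    by apply/proper_card/properP; split => //; exists y.
  by have := pmax x xZ; rewrite /geq /= leqNgt => /negbTE ->.
- have := cardsID (below v W p) Z; have :=
  subset_leq_card (subsetIr Z (below v W p)).
  have : p \in Z := pZ; rewrite inE => /andP[_ ?].
  by rewrite cZ cQ setIC; lia.
Qed.

End Staircase.

(** * The filling of the shape *)

Lemma ltn_nth_sort_geq j s i :
  (j < nth 0 (sort geq s) i) = (i < count (fun x => j < x) s).
Proof.
have tg : transitive geq by move=> p q r /= qp pr; apply: leq_trans qp.
have := sort_sorted (fun x y : nat => leq_total y x) s.
rewrite -(seq.permP (permEl (perm_sort geq s))).
elim: (sort geq s) i => [|x t IH] [|i] //=;
  rewrite (path_sortedE tg) => /andP[xt st].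
  case: ltnP => //= xj; rewrite add0n -has_count; symmetry;
    apply/negbTE/hasPn => y /(allP xt) /=.
  by rewrite -leqNgt => /leq_trans; apply.
rewrite IH //; case: (ltnP j x) => //= xj; rewrite add0n.
suff -> : count (fun x => j < x) t = 0 by [].
apply/eqP; rewrite -leqn0 leqNgt -has_count; apply/hasPn => y /(allP xt) /= yx.
by rewrite -leqNgt (leq_trans yx).
Qed.

Lemma leq_nth_sort_leq k s i : i < size s ->
  (k <= nth 0 (sort leq s) i) = (count (fun x => x < k) s <= i).
Proof.
rewrite -(size_sort leq s) -(seq.permP (permEl (perm_sort leq s))).
have := sort_sorted leq_total s.
elim: (sort leq s) i => [|x t IH] // [|i] /=;
  rewrite (path_sortedE leq_trans) => /andP[xt st] sz; last first.
  rewrite IH //; case: (ltnP x k) => //= kx; rewrite add0n.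
  suff -> : count (fun x => x < k) t = 0 by [].
  apply/eqP; rewrite -leqn0 leqNgt -has_count;
    apply/hasPn => y /(allP xt) /= xy.
  by rewrite -leqNgt (leq_trans kx).
case: (leqP k x) => //= kx; symmetry; rewrite add0n leqNgt -has_count;
  apply/hasPn => y /(allP xt) /=.
by rewrite -leqNgt => /(leq_trans kx).
Qed.

Section Filling.
Variables (n : nat) (v : 'S_n).
Implicit Types (i j k l p q x y z : 'I_n) (W I : {set 'I_n}) (c d : 'I_n * 'I_n)
  (Q : {set 'I_n * 'I_n}).
Local Notation T := [set: 'I_n].

(** At [(i, i)] this counts the dots strictly northwest of the dot of [i]. *)
Definition nwrank c : nat := #|[set z : 'I_n | (z < c.1) && (v z < v c.2)]|.

Lemma card_lt p : #|[set z : 'I_n | z < p]| = p.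
Proof.
have -> : [set z : 'I_n | z < p] = [set widen_ord (ltnW (ltn_ord p)) t | t : 'I_p].
  apply/setP => z; rewrite inE; apply/idP/imsetP => [zp|[t _ ->]] /=;
    last exact: ltn_ord.
  by exists (Ordinal zp) => //; apply/val_inj.
by rewrite card_imset ?card_ord // => s t /(congr1 val) /= /val_inj.
Qed.

Lemma card_vlt p : #|[set z : 'I_n | v z < v p]| = v p.
Proof.
rewrite -[RHS]card_lt -(card_imset _ (@perm_inj _ v)); apply: eq_card => z.
by rewrite !inE; apply/imsetP/idP => [[y + ->]|zp]; rewrite ?inE //;
   exists ((v^-1)%g z); rewrite ?inE permKV.
Qed.

Lemma nwrank_cidx c : c \in invs v T -> nwrank c + cidx v T c = c.1.
Proof.
case/invsP => _ _ lt1 lt2;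
  rewrite -[RHS]card_lt -(cardsID [set z : 'I_n | v z < v c.2]).
congr (_ + _); apply: eq_card => z; rewrite !inE /=; first by rewrite andbC.
by have := @vneq n v z c.2; rewrite -val_eqE /=; lia.
Qed.

Lemma nwrank_ridx c : c \in invs v T -> nwrank c + ridx v T c = v c.2.
Proof.
case/invsP => _ _ lt1 lt2;
  rewrite -[RHS]card_vlt -(cardsID [set z : 'I_n | z < c.1]).
congr (_ + _); apply: eq_card => z; rewrite !inE /=; first by rewrite andbC.
have : z = c.1 :> nat -> v z = v c.1 :> nat by move/val_inj->.
lia.
Qed.

Lemma rank_fun_nwrank c : c \in invs v T -> rank_fun v c.1 (v c.2) = nwrank c.
Proof.
case/invsP => _ _ lt1 lt2; apply: eq_card => z; rewrite !inE.
have : z = c.1 :> nat -> v z = v c.1 :> nat by move/val_inj->.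
by have := @vneq n v z c.2; rewrite -val_eqE /=; lia.
Qed.

Definition inv_cell d : 'I_n * 'I_n := (d.1, (v^-1)%g d.2).

Lemma inv_cell_inj : injective inv_cell.
Proof. by move=> [p q] [p' q'] [-> /perm_inj ->]. Qed.

Lemma rothe_invs d : (d \in rothe v) = (inv_cell d \in invs v T).
Proof. by rewrite !inE /= permKV andbC. Qed.

Lemma code_below p : code v p = #|below v T p|.
Proof.
rewrite -[RHS](card_imset _ (@perm_inj _ v)); apply: eq_card => q.
rewrite !inE /=; apply/andP/imsetP => [[qp pq]|[x + ->]].
  by exists ((v^-1)%g q); rewrite ?inE ?permKV //= pq.
by rewrite !inE permK /= => /andP[-> ->].
Qed.

Lemma shape_height d : (d \in Defs.shape v) = (d.1 < height v T d.2).
Proof.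
rewrite inE /lambda ltn_nth_sort_geq count_map; congr (_ < _).
rewrite /height cardE -size_filter; apply: perm_size; apply: uniq_perm.
- by rewrite filter_uniq ?enum_uniq.
- exact: enum_uniq.
- by move=> p; rewrite mem_filter !mem_enum !inE /= code_below andbT.
Qed.

(** Moves the cell of [c] northwest along its diagonal by its rank, by [nwrank_cidx] and
    [nwrank_ridx]. On inversions both indices are below [n], so the default of [insubd] is not
    taken. *)
Definition psi c : 'I_n * 'I_n :=
  (insubd c.1 (cidx v T c), insubd c.1 (ridx v T c)).

Lemma psiE c : c \in invs v T ->
  (psi c).1 = cidx v T c :> nat /\ (psi c).2 = ridx v T c :> nat.
Proof.
move=> cT; rewrite /psi /= !val_insubd.
have := nwrank_cidx cT; have := nwrank_ridx cT; have := ltn_ord c.1; have :=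
  ltn_ord (v c.2).
by do !case: ifP; lia.
Qed.

Hypothesis vex : vexillary v.

Lemma psi_inj : {in invs v T &, injective psi}.
Proof.
move=> c d cT dT; have [c1 c2] := psiE cT; have [d1 d2] := psiE dT.
by move=> e; apply: (idx_inj vex cT dT); rewrite -?c1 -?c2 -?d1 -?d2 e.
Qed.

Lemma shape_psi : Defs.shape v = psi @: invs v T.
Proof.
apply/setP => d; rewrite shape_height; apply/idP/imsetP => [|[c cT ->]].
  case/(idx_onto vex) => c cT [e1 e2]; exists c => //; have [c1 c2] := psiE cT.
  by case: d e1 e2 => a b /= e1 e2; congr (_, _); apply/val_inj;
    rewrite /= -?e1 -?e2.
by have [-> ->] := psiE cT; apply: cidx_lt.
Qed.

Lemma same_diag_psi d c : inv_cell d \in invs v T -> c \in invs v T ->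
  same_diag d (psi c) = (d.2 + c.1 == v c.2 + d.1).
Proof.
move=> dT cT; rewrite /same_diag; have [-> ->] := psiE cT.
have := nwrank_cidx cT; have := nwrank_ridx cT; lia.
Qed.

(* The equation says that the cells of [c] and [d] lie on the same diagonal. *)
Lemma nwrank_diag c d : c \in invs v T -> d \in invs v T ->
  v d.2 + c.1 = v c.2 + d.1 -> nwrank d < nwrank c -> cidx v T d < cidx v T c.
Proof.
move=> cT dT e lt_r.
have := nwrank_cidx cT; have := nwrank_ridx cT; have := nwrank_cidx dT; have :=
  nwrank_ridx dT.
have [dc|cd] := ltnP d.1 c.1.
  have h : v d.2 < v c.2 by lia.
  by have [|] := idx_lt vex dT cT dc h; lia.
(* Now the cell of [d] is weakly southeast of that of [c], so its rank cannot be smaller. *)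
have h : v c.2 <= v d.2 by lia.
suff : nwrank c <= nwrank d by lia.
apply: subset_leq_card; apply/subsetP => z; rewrite !inE => /andP[zc cz].
by rewrite (leq_trans zc cd) (leq_trans cz h).
Qed.

(** By [nwrank_diag] ranks weakly increase along each diagonal of the shape, so sorting puts the
    rank of [c] at [psi c]. The proof compares the number of values below [k] with the position
    [m c] on the diagonal. *)
Lemma filling_psi (k : nat) c : c \in invs v T ->
  (k <= filling v (psi c)) = (k <= nwrank c).
Proof.
move=> cT; rewrite /filling /diag_values.
pose E := [set d : 'I_n * 'I_n | (d \in invs v T) && (v d.2 + c.1 == v c.2 + d.1)].
pose m d := minn (cidx v T d) (ridx v T d).
have mE (d : 'I_n * 'I_n) : d \in E ->
  cidx v T d + m c = cidx v T c + m d /\ ridx v T d + m c = ridx v T c + m d.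
  rewrite inE => /andP[dT /eqP e]; rewrite /m.
  have := nwrank_cidx cT; have := nwrank_ridx cT; have := nwrank_cidx dT;
    have := nwrank_ridx dT.
  by case: (leqP (cidx v T d)) => ?; case: (leqP (cidx v T c)) => ?; lia.
have cE : c \in E by rewrite inE cT eqxx.
have EP (d : 'I_n * 'I_n) : d \in E ->
  d \in invs v T /\ v d.2 + c.1 = v c.2 + d.1.
  by rewrite inE => /andP[? /eqP ?].
have nwrank_m (d e : 'I_n * 'I_n) : d \in E -> e \in E ->
  nwrank d < nwrank e -> m d < m e.
  move=> dE eE; have [d1 d2] := mE d dE; have [e1 e2] := mE e eE.
  have [dT ed] := EP d dE; have [eT ee] := EP e eE; move=> lt_r.
  have h : v d.2 + e.1 = v e.2 + d.1 by lia.
  by have := nwrank_diag eT dT h lt_r; lia.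
have m_inj : {in E &, injective m}.
  move=> d e dE eE em; have [d1 d2] := mE d dE; have [e1 e2] := mE e eE.
  have [dT _] := EP d dE; have [eT _] := EP e eE.
  by apply: (idx_inj vex dT eT); lia.
have m_onto t : t <= m c -> exists2 d, d \in E & m d = t.
  move=> tc.
  (* The cell of the shape lying [m c - t] steps northwest of [psi c]. *)
  have [|d dT [d1 d2]] :=
    @idx_onto n v vex T (cidx v T c - (m c - t)) (ridx v T c - (m c - t)).
    apply: leq_ltn_trans (leq_subr _ _) _; apply: leq_trans (cidx_lt cT) _.
    apply: subset_leq_card; apply/subsetP => p; rewrite !inE /=; lia.
  exists d; last by rewrite /m d1 d2; rewrite /m in tc *; lia.
  rewrite inE dT; have := nwrank_cidx cT; have := nwrank_ridx cT.
  have m1 : m c <= cidx v T c by exact: geq_minl.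
  have m2 : m c <= ridx v T c by exact: geq_minr.
  by have := nwrank_cidx dT; have := nwrank_ridx dT; lia.
set D := [seq d <- enum (rothe v) | same_diag d (psi c)].
have memD d : (d \in D) = (inv_cell d \in E).
  rewrite mem_filter mem_enum rothe_invs [RHS]inE andbC.
  have [dT /=|//] := boolP (inv_cell d \in invs v T).
  by rewrite same_diag_psi //= permKV.
have countD (P : pred nat) : count P [seq rank_fun v d.1 d.2 | d <- D] = #|[set d in E | P (nwrank d)]|.
  rewrite count_map -size_filter cardE -(size_map inv_cell);
    apply/perm_size/uniq_perm.
  - rewrite (map_inj_uniq inv_cell_inj); apply: filter_uniq;
    apply: filter_uniq; exact: enum_uniq.
  - exact: enum_uniq.
  - move=> d; rewrite mem_enum inE; apply/mapP/andP => [[d' + ->]|[dE Pd]].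
      rewrite mem_filter memD /= => /andP[+ dE]; rewrite dE.
      have [dT _] := EP _ dE; have := rank_fun_nwrank dT.
      by rewrite /= permKV => ->.
    have ed : inv_cell (d.1, v d.2) = d by case: (d) => p x;
      rewrite /inv_cell /= permK.
    exists (d.1, v d.2) => //;
      rewrite mem_filter memD ed dE andbT /= rank_fun_nwrank //.
    by have [] := EP _ dE.
have -> : minn (psi c).1 (psi c).2 = m c by have [-> ->] := psiE cT.
have cm : m c < #|[set d in E | m d <= m c]|.
  rewrite cardE -(size_map m) -[(m c).+1](size_iota 0).
  apply: uniq_leq_size (iota_uniq _ _) _ => t; rewrite mem_iota ltnS /= => tc.
  have [d dE md] := m_onto t tc; apply/mapP; exists d => //.
  by rewrite mem_enum inE dE md.
rewrite leq_nth_sort_leq ?countD; last first.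
  rewrite -[size _](count_predT) countD; apply: leq_trans cm _.
  by apply: subset_leq_card; apply/subsetP => d; rewrite !inE => /andP[->].
have [kc|ck] := leqP k (nwrank c).
  apply: (@card_bounded _ _ m) => [d e|d].
    by rewrite inE => /andP[dE _]; rewrite inE => /andP[eE _]; apply: m_inj.
  by rewrite inE => /andP[dE dk]; apply: nwrank_m => //; apply: leq_trans kc.
apply/negbTE; rewrite -ltnNge; apply: leq_trans cm _.
apply: subset_leq_card; apply/subsetP => d.
rewrite [in X in X -> _]inE => /andP[dE]; rewrite [in X in _ -> X]inE dE /=.
apply: contraTT; rewrite -leqNgt -ltnNge => kd; apply: nwrank_m => //.
exact: leq_trans ck kd.
Qed.

Lemma tau_psi (k : nat) : tau v k = psi @: [set c in invs v T | k <= nwrank c].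
Proof.
apply/setP => d; rewrite inE shape_psi;
  apply/andP/imsetP => [[/imsetP[c cT ->]]|[c + ->]].
  by rewrite filling_psi // => kc; exists c; rewrite // inE cT.
by rewrite inE => /andP[cT kc]; rewrite filling_psi // kc imset_f.
Qed.

End Filling.

(** * Antidiagonal paths *)

Lemma antidiag_pathP n (P : {set 'I_n * 'I_n}) :
  reflect (forall c d, c \in P -> d \in P -> c != d ->
             antidiag_step c d || antidiag_step d c)
          (antidiag_path P).
Proof.
have tr : transitive (@antidiag_step n).
  by move=> y x z /andP[? ?] /andP[? ?]; rewrite /antidiag_step; lia.
apply: (iffP existsP) => [[s /andP[ss /eqP ->]] c d|stepP].
  rewrite !inE => cs ds cd; rewrite sorted_pairwise // in ss.
  have /(pairwiseP c) pw := ss.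
  move: (cs) (ds); rewrite -!index_mem => ic id.
  have := pw _ _ ic id; have := pw _ _ id ic; rewrite !nth_index //.
  case: (ltngtP (index c s) (index d s)) => [_ _ -> //|_ -> //|e];
    first by rewrite orbT.
  by move: cd; rewrite -(nth_index c cs) e nth_index ?eqxx.
pose le (c d : 'I_n * 'I_n) := c.1 <= d.1.
have le_tr : transitive le by move=> y x z; apply: leq_trans.
have le_tot : total le by move=> x y; apply: leq_total.
have sz : size (sort le (enum P)) == #|P| by rewrite size_sort cardE.
exists (Tuple sz); rewrite /= sorted_pairwise //; apply/andP; split; last first.
  by apply/eqP/setP => c; rewrite inE mem_sort mem_enum.
have := sort_sorted le_tot (enum P); have := enum_uniq P.
rewrite -(sort_uniq le) uniq_pairwise sorted_pairwise // => u l.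
have : pairwise [rel x y | le x y && (x != y)] (sort le (enum P)).
  by rewrite pairwise_relI l.
apply: (sub_in_pairwise (P := mem P)); last by apply/allP => c;
  rewrite mem_sort mem_enum.
move=> c d cP dP /= /andP[cd ne];
  case/orP: (stepP c d cP dP ne) => // /andP[dc _].
by move: cd; rewrite /le leqNgt dc.
Qed.

Lemma lsum_sum s :
  lsum s = \sum_(i < size s) (lis (nth 0 s i) (drop i.+1 s)).+1.
Proof.
by elim: s => [|x s IH]; rewrite ?big_ord0 // big_ord_recl /= drop0 IH.
Qed.

(** * Southeast sets and their excess *)

Section Blocks.
Variables (n : nat) (v : 'S_n).
Implicit Types (i j p q x y z : 'I_n) (W I : {set 'I_n}) (c d : 'I_n * 'I_n)
  (Q : {set 'I_n * 'I_n}).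
Local Notation T := [set: 'I_n].

Lemma drop_word p : drop p (word v) = (v p).+1 :: drop p.+1 (word v).
Proof. by rewrite (drop_nth 0) ?size_word // nth_word. Qed.

(** Induction on the length of the suffix: its first position is omitted or precedes a sequence of
    larger values. Words store [(v p).+1], so [a <= v p] is the strict bound in [lis]. *)
Lemma lis_increasing a (m : nat) : m <= n ->
  (exists I, [/\ increasing v I, forall p, p \in I -> (m <= p) && (a <= v p)
                & #|I| = lis a (drop m (word v))]) /\
  (forall I, increasing v I -> (forall p, p \in I -> (m <= p) && (a <= v p)) ->
    #|I| <= lis a (drop m (word v))).
Proof.
move=> mn; rewrite -[m](subKn mn); move: (n - m) (leq_subr m n) => {m mn} k.
elim: k a => [|k IH] a kn.
  rewrite subn0 drop_oversize ?size_word //; split=> [|I _ H].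
    by exists set0; rewrite cards0; split=> // p; rewrite inE.
  rewrite leqn0 cards_eq0; apply/eqP/setP => p; rewrite inE;
    apply/negbTE/negP => /H.
  by have := ltn_ord p; lia.
have lt_m : n - k.+1 < n by lia.
pose p0 := Ordinal lt_m; have em : n - k.+1 = p0 by [].
have em' : n - k = p0.+1 by rewrite /=; lia.
have {}IH a' := IH a' (ltnW kn); rewrite em' in IH;
  rewrite em drop_word [lis _ _]/=.
have gt_p0 I b : increasing v I -> (forall p, p \in I ->
  (p0 <= p) && (b <= v p)) ->
    p0 \notin I -> #|I| <= lis b (drop p0.+1 (word v)).
  move=> incI HI nI; apply: (IH b).2 => // p pI; have /andP[le1 ->] := HI p pI.
  rewrite andbT ltn_neqAle le1 andbT; apply: contraNneq nI => /val_inj ->.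
  exact: pI.
split.
  have [I1 [inc1 H1 c1]] := (IH a).1; have [I2 [inc2 H2 c2]] :=
    (IH (v p0).+1).1.
  have I1P : exists I, [/\ increasing v I, forall p, p \in I ->
    (p0 <= p) && (a <= v p)
                & #|I| = lis a (drop p0.+1 (word v))].
    by exists I1; split=> // p /H1 /andP[/ltnW-> ->].
  rewrite ltnS; case: leqP => // ap.
  have [le|lt] :=
    leqP (lis (v p0).+1 (drop p0.+1 (word v))).+1 (lis a (drop p0.+1 (word v))).
    exact: I1P.
  exists (p0 |: I2); split.
  - move=> p q; rewrite !in_setU1 => /predU1P[->|pI] /predU1P[->|qI].
    + by rewrite ltnn.
    + by have /andP[_ h] := H2 q qI.
    + by have /andP[h _] := H2 p pI; move/(ltn_trans h); rewrite ltnn.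
    + exact: inc2.
  - move=> p; rewrite in_setU1 => /predU1P[->|/H2 /andP[/ltnW -> /ltnW h]].
      by rewrite leqnn.
    by rewrite (leq_trans ap h).
  - by rewrite cardsU1 c2; case: (boolP (p0 \in I2)) => // /H2; rewrite ltnn.
move=> I incI HI; rewrite ltnS; have [pI|nI] := boolP (p0 \in I); last first.
  by have := gt_p0 I a incI HI nI; case: ifP => // _ /leq_trans; apply;
    apply: leq_maxl.
have /andP[_ ->] := HI p0 pI; apply: leq_trans (leq_maxr _ _).
rewrite (cardsD1 p0) pI add1n ltnS; apply: (IH _).2.
  by move=> p q; rewrite !inE => /andP[_ ?] /andP[_ ?]; apply: incI.
move=> p; rewrite !inE => /andP[pp0 pI']; have /andP[le _] := HI p pI'.
have lt : p0 < p by rewrite ltn_neqAle le andbT eq_sym val_eqE.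
by rewrite lt (incI _ _ pI pI' lt).
Qed.

Definition southeast i : {set 'I_n} := [set z : 'I_n | (i < z) && (v i < v z)].

(** The [lis] term is the length of a longest increasing sequence in [southeast i], see
    [lis_southeast]. *)
Definition excess i : nat := #|southeast i| - lis (v i).+1 (drop i.+1 (word v)).

Lemma lis_southeast i :
  (exists I, [/\ increasing v I, I \subset southeast i & #|I| = lis (v i).+1 (drop i.+1 (word v))]) /\
  (forall I, increasing v I -> I \subset southeast i ->
    #|I| <= lis (v i).+1 (drop i.+1 (word v))).
Proof.
have [[I [incI HI cI]] maxI] := lis_increasing (v i).+1 (ltn_ord i).
split; first by exists I; split=> //; apply/subsetP => p /HI; rewrite inE.
by move=> J incJ /subsetP sJ; apply: maxI => // p /sJ; rewrite inE.
Qed.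

Lemma card_southeast_below i : (#|southeast i| + #|below v T i|).+1 + i = n.
Proof.
have := cardsC [set z : 'I_n | z <= i]; rewrite card_ord.
have -> : [set z : 'I_n | z <= i] = i |: [set z : 'I_n | z < i].
  by apply/setP => z; rewrite !inE leq_eqVlt val_eqE.
rewrite cardsU1 inE ltnn card_lt.
have -> : ~: (i |: [set z : 'I_n | z < i]) = southeast i :|: below v T i.
  apply/setP => z; rewrite !inE negb_or -leqNgt -val_eqE /=.
  by have := @vneq n v z i; rewrite -val_eqE /=; lia.
rewrite cardsU; have -> : southeast i :&: below v T i = set0.
  by apply/setP => z; rewrite !inE; lia.
by rewrite cards0 subn0 add1n addSn [i + _]addnC -addSn.
Qed.

Lemma card_rothe : #|rothe v| = \sum_i #|below v T i|.
Proof.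
rewrite -(eq_bigr _ (fun i _ => code_below v i)) -sum1_card.
rewrite (eq_bigr (fun i => \sum_(j | (i, j) \in rothe v) 1)); last first.
  by move=> i _; rewrite sum1_card; apply: eq_card => j; rewrite inE.
rewrite (pair_big_dep xpredT (fun i j => (i, j) \in rothe v) (fun _ _ => 1)) /=.
by apply: eq_bigl => -[].
Qed.

(** The sets [southeast i] and [below v T i] partition the positions other than [i] that do not
    precede it, so the sum is [n - i]; [bump 0 (rev_ord i)] is how this number appears when
    ['C(n.+1, 2)] is expanded. *)
Lemma lis_below_excess i :
  (lis (v i).+1 (drop i.+1 (word v))).+1 + #|below v T i| + excess i
  = bump 0 (rev_ord i).
Proof.
have [[I [_ sI cI]] _] := lis_southeast i; have := subset_leq_card sI;
  rewrite cI.
have := card_southeast_below i; rewrite /excess /= /bump /=.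
move: #|southeast i| #|below v T i| (lis _ _) => a b c; lia.
Qed.

Lemma lsum_word : lsum (word v) + #|rothe v| + \sum_i excess i = 'C(n.+1, 2).
Proof.
rewrite lsum_sum size_word card_rothe -!big_split /=.
rewrite -bin2_sum big_mkord.
rewrite big_ord_recl add0n [RHS](reindex_inj rev_ord_inj).
by apply: eq_bigr => i _; rewrite nth_word lis_below_excess.
Qed.

Hypothesis vex : vexillary v.

Lemma excess_antidiagonal i :
  (exists Q, [/\ Q \subset invs v (southeast i), antidiagonal v (southeast i) Q & #|Q| = excess i]) /\
  (forall Q, Q \subset invs v (southeast i) ->
    antidiagonal v (southeast i) Q -> #|Q| <= excess i).
Proof.
have [[J [incJ sJ cJ]] maxJ] := lis_southeast i.
have max Q : Q \subset invs v (southeast i) ->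
  antidiagonal v (southeast i) Q -> #|Q| <= excess i.
  by move=> sQ aQ; have := antidiagonal_increasing sQ aQ sJ incJ;
    rewrite cJ /excess; lia.
split=> //; have [Q [I [sQ aQ sI incI le]]] :=
  antidiagonal_exists vex (southeast i).
exists Q; split=> //; have := max Q sQ aQ; have := maxJ I incI sI;
  rewrite /excess; lia.
Qed.

End Blocks.

(** * Splitting [tau] into southeast blocks *)

Section RankBlocks.
Variables (n : nat) (v : 'S_n).
Implicit Types (i j p q x y z : 'I_n) (W I : {set 'I_n}) (c d : 'I_n * 'I_n)
  (Q : {set 'I_n * 'I_n}).
Local Notation T := [set: 'I_n].
Hypothesis vex : vexillary v.

Lemma southeast_invs i c :
  (c \in invs v (southeast v i)) = [&& c \in invs v T, i < c.1 & v i < v c.2].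
Proof. by rewrite !inE /=; apply/idP/idP; lia. Qed.

(** Otherwise [i], [j], [c.1], [c.2] form 2143. *)
Lemma nw_increasing c i j : c \in invs v T -> i < j -> j < c.1 ->
  v i < v c.2 -> v i < v j.
Proof.
move=> /invsP[_ _ c12 c21] ij jc ic; apply: contraT => /(v_ltP ij) ji; exfalso.
exact: (vexP vex ij jc c12 ji ic c21).
Qed.

(** Restricting to [southeast v i] loses the dots above row [i] and right of the cell. By
    [nw_increasing] these are all the dots above row [i] and right of the dot of [i], so the offset
    is the same for every [c]. *)
Lemma cidx_southeast i c : c \in invs v (southeast v i) ->
  cidx v T c + nwrank v (i, i) = cidx v (southeast v i) c + i.
Proof.
rewrite southeast_invs => /and3P[cT ic1 ic2].
have -> : cidx v T c = cidx v (southeast v i) c + #|[set z : 'I_n | (z < i) && (v c.2 < v z)]|.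
  rewrite /cidx -(cardsID (southeast v i)); congr (_ + _); apply: eq_card => z;
    rewrite !inE /=; first lia.
  have : z = i :> nat -> v z = v i :> nat by move/val_inj->.
  lia.
rewrite -addnA; congr (_ + _);
  rewrite addnC -[RHS]card_lt -[RHS](cardsID [set z : 'I_n | v z < v i]).
congr (_ + _); apply: eq_card => z; rewrite !inE /=; first by rewrite andbC.
case: (ltnP z i) => zi; rewrite ?andbF // !andbT -leqNgt /=.
have := @vneq n v z i; have := @vneq n v z c.2; rewrite -!val_eqE /=.
have := @nw_increasing c z i cT zi ic1; have [_ _ lt1 _] := invsP cT; lia.
Qed.

Lemma ridx_southeast i c : c \in invs v (southeast v i) ->
  ridx v T c + nwrank v (i, i) = ridx v (southeast v i) c + v i.
Proof.
rewrite southeast_invs => /and3P[cT ic1 ic2].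
have -> : ridx v T c = ridx v (southeast v i) c + #|[set z : 'I_n | (c.1 < z) && (v z < v i)]|.
  rewrite /ridx -(cardsID (southeast v i)); congr (_ + _); apply: eq_card => z;
    rewrite !inE /=; first lia.
  have := @vneq n v z i; rewrite -val_eqE /=; lia.
rewrite -addnA; congr (_ + _);
  rewrite addnC -[RHS]card_vlt -[RHS](cardsID [set z : 'I_n | z < i]).
congr (_ + _); apply: eq_card => z; rewrite !inE /=; first by rewrite andbC.
have : z = i :> nat -> v z = v i :> nat by move/val_inj->.
have : z = c.1 :> nat -> v z = v c.1 :> nat by move/val_inj->.
have [_ _ _ lt2] := invsP cT.
have := @nw_increasing c i z cT; lia.
Qed.

(** The dots strictly northwest of the cell form an increasing chain, so the one preceded by [k]
    others has rank [k]. *)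
Lemma nwrank_southeast (k : nat) c : c \in invs v T ->
  k < nwrank v c ->
    exists i, nwrank v (i, i) = k /\ c \in invs v (southeast v i).
Proof.
move=> cT kc; have inj : {in [set z : 'I_n | (z < c.1) && (v z < v c.2)] &,
  injective (fun z : 'I_n => z : nat)} by move=> ? ? _ _ /val_inj.
case/(rank_onto inj): kc => i; rewrite inE => /andP[ic1 ic2] <-.
exists i; rewrite southeast_invs cT ic1 ic2; split=> //; apply: eq_card => z;
  rewrite !inE /=.
apply/idP/idP => [/andP[zi zv]|/andP[/andP[zc zv] zi]].
  by rewrite zi (ltn_trans zi ic1) (ltn_trans zv ic2).
by rewrite zi (nw_increasing cT zi).
Qed.

Lemma southeast_nwrank i c : c \in invs v (southeast v i) ->
  nwrank v (i, i) < nwrank v c.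
Proof.
rewrite southeast_invs => /and3P[cT ic1 ic2]; apply/proper_card/properP; split.
  by apply/subsetP => z; rewrite !inE /= => /andP[/ltn_trans-> // /ltn_trans->].
by exists i; rewrite !inE /= ?ltnn // ic1.
Qed.

(** Dots of equal rank descend to the left. By [nw_increasing] the block of [i] stays weakly above
    row [j] and that of [j] weakly left of column [v i]; the larger ranks of the cells make the
    separation strict in the shape. *)
Lemma southeast_step i j c d : nwrank v (i, i) = nwrank v (j, j) -> i < j ->
  c \in invs v (southeast v i) -> d \in invs v (southeast v j) ->
    ad_step v T c d.
Proof.
move=> e ij cS dS; have rc := southeast_nwrank cS; have rd :=
  southeast_nwrank dS.
have shc := cidx_southeast dS; have shr := ridx_southeast cS.
move: cS dS; rewrite !southeast_invs => /and3P[cT ic1 ic2] /and3P[dT jd1 jd2].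
have := nwrank_cidx cT; have := nwrank_ridx dT => edr ecc.
have ji : v j < v i.
  apply: (v_ltP ij); apply/negP => vij;
    suff : nwrank v (i, i) < nwrank v (j, j) by rewrite e ltnn.
  apply/proper_card/properP; split.
    by apply/subsetP => z;
      rewrite !inE /= => /andP[/ltn_trans-> // /ltn_trans->].
  by exists i; rewrite !inE /= ?ltnn // ij.
have cj : c.1 <= j.
  rewrite leqNgt; apply/negP => jc.
  by have := nw_increasing cT ij jc ic2; rewrite ltnNge ltnW.
have di : v d.2 <= v i.
  rewrite leqNgt; apply/negP => id.
  by have := nw_increasing dT ij jd1 id; rewrite ltnNge ltnW.
by split; lia.
Qed.

Lemma antidiagonal_southeast i Q : Q \subset invs v (southeast v i) ->
  (antidiagonal v T Q <-> antidiagonal v (southeast v i) Q).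
Proof.
move=> /subsetP sQ; suff h c d : c \in Q -> d \in Q ->
    (ad_step v T c d <-> ad_step v (southeast v i) c d).
  by split=> aQ c d cQ dQ cd; have := aQ c d cQ dQ cd; have := h c d cQ dQ;
    have := h d c dQ cQ;
     tauto.
move=> /sQ cS /sQ dS; have := cidx_southeast cS; have := cidx_southeast dS.
have := ridx_southeast cS; have := ridx_southeast dS; rewrite /ad_step; lia.
Qed.

(** The blocks of the dots of rank [k] cut a path into pieces, each bounded by [excess]. Conversely,
    largest antidiagonals of these blocks unite to one path by [southeast_step]. *)
Lemma rho_a_tau (k : nat) :
  rho_a (tau v k.+1) = \sum_(i | nwrank v (i, i) == k) excess v i.
Proof.
rewrite tau_psi //; set X := [set c in invs v T | k < nwrank v c].
have sX : X \subset invs v T by apply/subsetP => c; rewrite inE => /andP[].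
have path_ad Q : Q \subset X -> antidiag_path (psi v @: Q) <->
  antidiagonal v T Q.
  move=> sQ; have psiQ c : c \in Q -> c \in invs v T.
    by move=> cQ; apply/(subsetP sX)/(subsetP sQ).
  have stepE c d : c \in Q -> d \in Q -> antidiag_step (psi v c) (psi v d) <->
    ad_step v T c d.
    move=> /psiQ cT /psiQ dT; have [c1 c2] := psiE cT; have [d1 d2] := psiE dT.
    by rewrite /antidiag_step c1 c2 d1 d2 /ad_step; split=> [/andP|[-> ->]].
  split=> [/antidiag_pathP H c d cQ dQ cd|H].
    have ne : psi v c != psi v d.
      by apply: contraNneq cd => /(psi_inj vex (psiQ c cQ) (psiQ d dQ))->.
    by case/orP: (H _ _ (imset_f _ cQ) (imset_f _ dQ) ne) => /stepE;
      [left|right]; auto.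
  apply/antidiag_pathP => _ _ /imsetP[c cQ ->] /imsetP[d dQ ->] cd.
  have ne : c != d by apply: contraNneq cd => ->.
  by case: (H c d cQ dQ ne) => /stepE -> //; rewrite ?orbT.
have card_psi Q : Q \subset X -> #|psi v @: Q| = #|Q|.
  move=> /subsetP sQ; apply: card_in_imset => c d /sQ cX /sQ dX.
  by apply: (psi_inj vex); apply: (subsetP sX).
apply/eqP; rewrite eqn_leq; apply/andP; split.
  apply/bigmax_leqP => P /andP[pathP /subsetP sP].
  pose Q := [set c in X | psi v c \in P].
  have sQ : Q \subset X by apply/subsetP => c; rewrite inE => /andP[].
  have eP : P = psi v @: Q.
    apply/setP => d; apply/idP/imsetP => [dP|[c + ->]];
      last by rewrite inE => /andP[].
    by have /imsetP[c cX e] := sP d dP; exists c => //; rewrite inE cX -e.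
  rewrite eP card_psi //; rewrite eP in pathP; have aQ :=
    (path_ad Q sQ).1 pathP.
  have bound i : #|Q :&: invs v (southeast v i)| <= excess v i.
    apply: (excess_antidiagonal vex i).2; first exact: subsetIr.
    apply/antidiagonal_southeast; first exact: subsetIr.
    by move=> c d; rewrite !in_setI => /andP[cQ _] /andP[dQ _]; apply: aQ.
  apply: leq_trans (leq_sum _ (fun i _ => bound i)).
  rewrite -sum1_card (eq_bigr (fun i => \sum_(c in Q) (c \in invs v (southeast v i)))); last first.
    move=> i _; rewrite -sum1_card big_mkcond [RHS]big_mkcond;
      apply: eq_bigr => c _.
    by rewrite in_setI; case: (c \in Q) => //; case: (c \in _).
  rewrite exchange_big /=; apply: leq_sum => c cQ.
  have := subsetP sQ c cQ; rewrite inE => /andP[cT kc].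
  have [i [ei ci]] := nwrank_southeast cT kc.
  by rewrite (bigD1 i) ?ei //= ci.
have [F FP] := fin_all_exists (fun i => (excess_antidiagonal vex i).1).
pose G i := if nwrank v (i, i) == k then F i else set0.
have GP i c : c \in G i ->
  [/\ nwrank v (i, i) = k, c \in F i & c \in invs v (southeast v i)].
  rewrite /G; case: eqP => [e cF|_]; rewrite ?in_set0 //; split=> //.
  by have [/subsetP sF _ _] := FP i; apply: sF.
pose U := \bigcup_i G i.
have sU : U \subset X.
  apply/bigcupsP => i _; apply/subsetP => c /GP[e _ cS].
  by rewrite inE -e southeast_nwrank // andbT; move: cS;
    rewrite southeast_invs => /andP[].
have aU : antidiagonal v T U.
  move=> c d /bigcupP[i _ /GP[ei cF cS]] /bigcupP[j _ /GP[ej dF dS]] cd.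
  case: (ltngtP i j) => [ij|ji|/val_inj e].
  - by left; apply: (southeast_step _ ij cS dS); rewrite ei.
  - by right; apply: (southeast_step _ ji dS cS); rewrite ei.
  - subst j; have [sF aF _] := FP i;
    exact: (antidiagonal_southeast sF).2 aF c d cF dF cd.
(* A cell in two blocks would precede itself on an antidiagonal. *)
have dG i j : i != j -> [disjoint G i & G j].
  move=> ij; apply/pred0P => c /=;
    apply/negbTE/negP => /andP[/GP[ei _ ci] /GP[ej _ cj]].
  move: ij; rewrite -val_eqE neq_ltn => /orP[] lt.
    have [h _] : ad_step v T c c by apply: (southeast_step _ lt ci cj);
      rewrite ei.
    by rewrite ltnn in h.
  have [h _] : ad_step v T c c by apply: (southeast_step _ lt cj ci);
    rewrite ei.
  by rewrite ltnn in h.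
have cU : #|U| = \sum_(i | nwrank v (i, i) == k) excess v i.
  rewrite -sum1_card partition_disjoint_bigcup // [RHS]big_mkcond.
  apply: eq_bigr => i _; rewrite sum1_card /G; case: ifP => _;
    rewrite ?cards0 //.
  by have [_ _ ->] := FP i.
rewrite -cU -(card_psi U sU); apply: leq_bigmax_cond.
by rewrite (path_ad U sU).2 //= imsetS.
Qed.

(** Each [i] is counted once, at the level given by [nwrank v (i, i)], which is below [n]. *)
Lemma sum_rho_a_tau :
  \sum_(1 <= k < n.+1) rho_a (tau v k) = \sum_i excess v i.
Proof.
rewrite big_add1 /= big_mkord (eq_bigr _ (fun (k : 'I_n) _ => rho_a_tau k)).
have nwrank_lt i : nwrank v (i, i) < n.
  apply: leq_ltn_trans (ltn_ord i); rewrite -[leqRHS]card_lt.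
  by apply: subset_leq_card; apply/subsetP => z; rewrite !inE => /andP[].
rewrite [RHS](partition_big (fun i => Ordinal (nwrank_lt i)) predT) //=.
Qed.

End RankBlocks.

(* [msize] is the total degree plus one (and 0 for the zero polynomial). *)
Theorem theorem1p7 (n : nat) (v : 'S_n) (G : {mpoly int[n]}) :
  vexillary v -> groth v G ->
  msize G = (#|rothe v| + \sum_(1 <= k < n.+1) rho_a (tau v k)).+1.
Proof.
move=> vex /groth_pipe_poly ->; rewrite sum_rho_a_tau //.
have xv i : i.+1 < n -> exists j : 'I_n, xvar n i = ('X_j)%R.
  by move=> /ltnW lt_in; exists (Ordinal lt_in); rewrite -xvar_ord.
have [_] := pipe_poly_alternating (size_word v) xv (uniq_word v) (word_gt0 v).
have := lsum_word v;
  move: (msize _) (lsum _) #|rothe v| (bigop _ _ _) => a b c d.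
lia.
Qed.
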